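(* Let $F$ be a finite group containing at least two elements, and let $\mu$ be a measure on $G=\mathbb{Z}^2\wr F$ which defines a standard aperiodic switch-walk-switch random walk. Let $\nu$ be the projection of $\mu$ to $\mathbb{Z}^2$, and assume that the support of $\nu$ consists of $5$ elements: the two standard generators of $\mathbb{Z}^2$, their inverses and the neutral element. Then the radius of individual almost invariance of $(G,\mu)$ satisfies $$\bar r(n)\succeq r_{\rm cov}(\nu,n).$$
   Context: The wreath product $A\wr B$ is the semidirect product of $A$ and $\sum_A B$ (finitely supported functions $A\to B$), where $A$ acts by shifts; $A$ and $B$ are embedded in the standard way ($B$ as functions supported at $e_A$). A standard switch-walk-switch random walk on $\mathbb{Z}^2\wr F$ is given by $\mu=\mu_F*\mu_{\mathbb{Z}^2}*\mu_F$ with $\mu_F$ the uniform distribution on $F$ and $\mu_{\mathbb{Z}^2}$ a symmetric measure on $\mathbb{Z}^2$ (here with the $5$-element support above). Aperiodic means that the greatest common divisor of the $K\ge 1$ with $\mu^{*K}(e)>0$ is $1$. $r_{\rm cov}(n)=r_{\rm cov}(\nu,n)$ is a function such that for any $\epsilon>0$ there exists $c>0$ with the following property: for all sufficiently large $n$, the set of points of $\mathbb{Z}^2$ visited at least once until the moment $n$ by the random walk $(\mathbb{Z}^2,\nu)$ started at the origin contains the ball of radius $c\,r_{\rm cov}(n)$ centered at the origin with probability at least $1-\epsilon$. (The claim is for any function $r_{\rm cov}$ with this property.) Let $S$ be a finite generating set of $G$ with word length $l_{G,S}$. For $r:\mathbb{N}\to[0,\infty)$, $(G,\mu)$ has individually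 almost invariant distributions on the scale $r(n)$ if for every $\epsilon>0$ and every sequence $g_n\in G$ with $l_{G,S}(g_n)\le r(n)$ there exist subsets $V_{\epsilon,n}\subset G$ such that for all sufficiently large $n$: $\mu^{*n}(V_{\epsilon,n})\ge 1-\epsilon$, and for all $h\in V_{\epsilon,n}$, $\mu^{*n}(h)>0$ and $|\mu^{*n}(hg_n)/\mu^{*n}(h)-1|\le\epsilon$. The relation $\bar r(n)\succeq r(n)$ means: $(G,\mu)$ has individually almost invariant distributions on the scale $r''(n)$ for any $r''(n)$ with $r''(n)/r(n)\to 0$. *)

(* Defs.v *)
From HB Require Import structures.
From mathcomp Require Import all_boot all_order all_fingroup all_algebra finmap.
From mathcomp Require Import all_classical all_reals all_analysis.

Set Implicit Arguments.
Unset Strict Implicit.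
Unset Printing Implicit Defensive.

Import Order.TTheory GRing.Theory Num.Theory.
Import numFieldNormedType.Exports.

Local Open Scope classical_set_scope.
Local Open Scope ring_scope.

(* The lamplighter (x, f) has cursor x : A and lamp configuration f : A -> B;
   A is written additively, so that A = Z^2 is int * int.  The product is
     (x, f) (y, g) = (x + y, z |-> f z * g (z - x)),
   so right multiplication by an element of B changes the lamp at the cursor
   and right multiplication by an element of A moves the cursor. *)
Definition wreath (A : zmodType) (B : groupType) : Type :=
  (A * {fsfun A -> B with 1%g})%type.

HB.instance Definition _ (A : zmodType) (B : groupType) :=
  Choice.on (wreath A B).

Section WreathGroup.
Variables (A : zmodType) (B : groupType).
Implicit Types u v w : wreath A B.

Definition wreath_one : wreath A B := (0, [fsfun of _ => 1%g]).

Definition wreath_mul u v : wreath A B :=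
  (u.1 + v.1,
   [fsfun z in (finsupp u.2 `|` [fset (u.1 + y)%R | y in finsupp v.2])%fset
      => (u.2 z * v.2 (z - u.1))%g | 1%g]).

Definition wreath_inv u : wreath A B :=
  (- u.1,
   [fsfun z in [fset (y - u.1)%R | y in finsupp u.2]%fset
      => (u.2 (z + u.1)%R)^-1%g | 1%g]).

Lemma wreath_mulE u v z :
  (wreath_mul u v).2 z = (u.2 z * v.2 (z - u.1)%R)%g.
Proof.
rewrite /= fsfun_fun in_fsetU; case: (finsuppP u.2 z) => //= _.
case: ifP => // /negP zN; rewrite fsfun_dflt ?mulg1//.
apply/negP => zv; apply: zN; apply/imfsetP; exists (z - u.1) => //.
by rewrite addrC subrK.
Qed.

Lemma wreath_invE u z : (wreath_inv u).2 z = (u.2 (z + u.1)%R)^-1%g.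
Proof.
rewrite /= fsfun_fun; case: ifP => // /negP zN; rewrite fsfun_dflt ?invg1//.
apply/negP => zu; apply: zN; apply/imfsetP; exists (z + u.1) => //.
by rewrite addrK.
Qed.

Lemma wreath_eq u v : u.1 = v.1 -> u.2 =1 v.2 -> u = v.
Proof. by case: u v => [x f] [y g] /= -> /fsfunP ->. Qed.

Lemma wreath_mulA : associative wreath_mul.
Proof.
move=> u v w; apply: wreath_eq => [/=|z]; first by rewrite addrA.
by rewrite !wreath_mulE /= mulgA opprD addrA.
Qed.

Lemma wreath_mul1 : left_id wreath_one wreath_mul.
Proof.
move=> u; apply: wreath_eq => [/=|z]; first by rewrite add0r.
by rewrite wreath_mulE /= fsfun0E mul1g subr0.
Qed.

Lemma wreath_mulr1 : right_id wreath_one wreath_mul.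
Proof.
move=> u; apply: wreath_eq => [/=|z]; first by rewrite addr0.
by rewrite wreath_mulE /= fsfun0E mulg1.
Qed.

Lemma wreath_mulV : left_inverse wreath_one wreath_inv wreath_mul.
Proof.
move=> u; apply: wreath_eq => [/=|z]; first by rewrite addNr.
by rewrite wreath_mulE wreath_invE /= fsfun0E opprK mulVg.
Qed.

Lemma wreath_mulrV : right_inverse wreath_one wreath_inv wreath_mul.
Proof.
move=> u; apply: wreath_eq => [/=|z]; first by rewrite addrN.
by rewrite wreath_mulE wreath_invE /= fsfun0E subrK mulgV.
Qed.

HB.instance Definition _ := isGroup.Build (wreath A B)
  wreath_mulA wreath_mul1 wreath_mulr1 wreath_mulV wreath_mulrV.

Definition cursor u : A := u.1.

Definition base_embed (x : A) : wreath A B := (x, [fsfun of _ => 1%g]).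

Definition lamp_embed (b : B) : wreath A B :=
  (0, [fsfun z in [fset 0%R]%fset => b | 1%g]).

End WreathGroup.

(* A measure on a discrete set T is given by its point masses, T -> R. *)
Section DiscreteMeasures.
Variable R : realType.

Definition prob_mass (T : choiceType) (m : T -> R) : Prop :=
  (forall x, 0 <= m x) /\ (\esum_(x in [set: T]) (m x)%:E = 1)%E.

Definition mass (T : choiceType) (m : T -> R) (V : set T) : \bar R :=
  (\esum_(x in V) (m x)%:E)%E.

Definition push (T U : choiceType) (f : T -> U) (m : T -> R) : U -> R :=
  fun y => fine (mass m (f @^-1` [set y])).

Definition uniform_mass (T : finType) : T -> R := fun=> (#|T|%:R)^-1.

Definition symmetric_mass (A : zmodType) (m : A -> R) : Prop :=
  forall x, m (- x) = m x.

Definition convolution (G : groupType) (m1 m2 : G -> R) : G -> R :=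
  fun g => fine (\esum_(h in [set: G]) (m1 h * m2 (h^-1 * g)%g)%:E)%E.

Definition conv_pow (G : groupType) (m : G -> R) (n : nat) : G -> R :=
  iter n (convolution m) (fun g => (g == 1%g)%:R).

Definition is_gcd_of (P : set nat) (d : nat) : Prop :=
  (forall k, P k -> (d %| k)%N) /\
  (forall e : nat, (forall k, P k -> (e %| k)%N) -> (e %| d)%N).

Definition aperiodic (G : groupType) (m : G -> R) : Prop :=
  is_gcd_of [set k | (0 < k)%N /\ 0 < conv_pow m k 1%g] 1%N.

End DiscreteMeasures.

Definition is_word (G : groupType) (S : {fset G}) (w : seq G) : bool :=
  all (fun s => (s \in S) || (s^-1%g \in S)) w.

Definition spelled_in (G : groupType) (S : {fset G}) (g : G) (n : nat) : Prop :=
  exists w : seq G, [/\ is_word S w, size w = n & (\prod_(s <- w) s)%g = g].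

Definition generates (G : groupType) (S : {fset G}) : Prop :=
  forall g : G, exists n, spelled_in S g n.

(* The value is 0 if g is not in the subgroup generated by S. *)
Definition word_length (G : groupType) (S : {fset G}) (g : G) : nat :=
  if pselect (exists n, `[< spelled_in S g n >]) is left ex then ex_minn ex
  else 0%N.

Section AlmostInvariance.
Variables (R : realType) (G : groupType) (S : {fset G}) (mu : G -> R).

Definition individually_almost_invariant (r : nat -> R) : Prop :=
  forall eps : R, 0 < eps ->
  forall g : nat -> G, (forall n, (word_length S (g n))%:R <= r n) ->
  exists V : nat -> set G, \forall n \near \oo,
    ((1 - eps)%:E <= mass (conv_pow mu n) (V n))%E /\
    (forall h, V n h ->
       0 < conv_pow mu n h /\
       `| conv_pow mu n (h * g n)%g / conv_pow mu n h - 1 | <= eps).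

(* The first clause is needed because x / 0 = 0 here. *)
Definition ratio_to_0 (r' r : nat -> R) : Prop :=
  (\forall n \near \oo, r n = 0 -> r' n = 0) /\
  (r' n / r n @[n --> \oo] --> (0 : R)).

Definition invariance_radius_succeq (r : nat -> R) : Prop :=
  forall r' : nat -> R, (forall n, 0 <= r' n) -> ratio_to_0 r' r ->
  individually_almost_invariant r'.

End AlmostInvariance.

Section PlaneWalk.
Variable R : realType.
Local Notation Z2 := (int * int)%type.

(* Closed ball about 0 in the word metric of the standard generators. *)
Definition Z2_ball (rho : R) : set Z2 :=
  [set z | (`|z.1| + `|z.2|)%:~R <= rho].

(* The range of the walk with increments s, started at 0, at times
   0, 1, ..., size s. *)
Definition visited (s : seq Z2) : set Z2 :=
  [set z | exists2 k, (k <= size s)%N & z = \sum_(x <- take k s) x].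

(* The first n increments of the walk have law nu^{\otimes n}. *)
Definition prob_covers (nu : Z2 -> R) (n : nat) (K : set Z2) : \bar R :=
  (\esum_(s in [set s : n.-tuple Z2 | K `<=` visited s])
     (\prod_(x <- s) nu x)%:E)%E.

Definition cov_radius (nu : Z2 -> R) (r : nat -> R) : Prop :=
  forall eps : R, 0 < eps ->
  exists2 c : R, 0 < c & \forall n \near \oo,
    ((1 - eps)%:E <= prob_covers nu n (Z2_ball (c * r n)))%E.

Definition Z2_steps : set Z2 :=
  [set z | z \in [:: (0, 0); (1, 0); (-1, 0); (0, 1); (0, -1)]].

Definition switch_walk_switch (F : finGroupType) (muZ : Z2 -> R) :
    wreath Z2 F -> R :=
  let muF := push (@lamp_embed Z2 F) (@uniform_mass R F) in
  convolution (convolution muF (push (@base_embed Z2 F) muZ)) muF.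

Definition standard_switch_walk_switch (F : finGroupType)
    (mu : wreath Z2 F -> R) : Prop :=
  exists muZ : Z2 -> R,
    [/\ prob_mass muZ, symmetric_mass muZ & mu = switch_walk_switch muZ].

End PlaneWalk.

(* Main.v *)
Require Import Defs.
From HB Require Import structures.
From mathcomp Require Import all_boot all_order all_fingroup all_algebra finmap.
From mathcomp Require Import all_classical all_reals all_analysis.
From mathcomp Require Import ring lra zify.

Set Implicit Arguments.
Unset Strict Implicit.
Unset Printing Implicit Defensive.

Import Order.TTheory GRing.Theory Num.Theory.
Import numFieldNormedType.Exports.

Local Open Scope classical_set_scope.
Local Open Scope ring_scope.

(** It is enough to prove that right multiplication by [g n] changes the law
    mu^n little in total variation: if it changes the expectation of no function
    with values in [0, 1] by more than delta, then by Markov's inequality the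
    ratio mu^n(h g)/mu^n(h) is off 1 by more than eps only on a set of h of
    mu^n-mass at most 2 delta/eps ([almost_invariant_mass]).

    Write g = (0, k)(y, 1), where y and the support of k lie in a ball of radius
    r, a constant multiple of the word length of g, hence o(r_cov(n)).

    - Lamps.  Each site on the path has its lamp multiplied by a uniform element
      of F, so the factor (0, k) goes unnoticed unless some site of the support
      of k, seen from the final position, was never visited.  Read backwards
      from there, the path is again one of the walk, so the cost is at most the
      probability that a walk from 0 fails to cover that support
      ([lamps_cost]).

    - Cursor.  Let M = (s r)^2 and L = s^2 r for a large constant s, and single
      out the last M steps.  They alter only lamps within distance L of the
      position at time n - M, up to probability 2 M/L^2 ([exit_le]).  If the
      first n - M steps have covered the ball of radius L around their endpoint,
      these alterations go unnoticed as well, so that the last M steps act only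
      by their displacement, whose law changes by O(|y|/sqrt M) when it is
      shifted by y ([walk_smooth], [shift_cost]).

    What is left is to cover the ball of radius L already at time n - M
    ([miss_earlier]), when only covering at time n is given, and r_cov may vary
    wildly with n.  Since r_cov(n)/L is large there is room for a third scale
    D = 2^I L between L and r_cov(n).  By translation, a walk started at a point
    v within 2 D of the origin covers the ball of radius L around 0 by time n.
    For a suitable v it stays outside this ball up to time T, of order (s D)^2
    ([hit_small]), so the covering takes place between the times T and n.  After
    T - M steps a walk from 0 has nearly the law that the walk from v has after
    T steps, because T is much larger than D^2 and M; hence the walk from 0
    covers the ball by time n - M.

    The existence of v is a quantitative form of recurrence.  On average over v
    in a box of side D, the walk from v spends an expected time O(L^2) near the
    ball of radius L, by counting; but a walk that hits this ball spends an
    expected time of order L^2 log(D/L) near it ([green_ball_ge]), because of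
    the lower bound L^2/n for the return probabilities ([heat_kernel_ge]). *)

(** * Expectations under finitely supported laws *)

Section Expectation.
Variable R : realType.

(** A law is a list of weighted atoms, repetitions allowed: products and images
    of laws are then plain list operations, and no summability arises. *)
Definition expect (T : Type) (l : seq (R * T)) (f : T -> R) : R :=
  \sum_(p <- l) p.1 * f p.2.

Definition is_law (T : eqType) (l : seq (R * T)) : Prop :=
  (forall p, p \in l -> 0 <= p.1) /\ \sum_(p <- l) p.1 = 1.

Section Generic.
Variable T : eqType.
Implicit Types (l : seq (R * T)) (f g : T -> R).

Lemma eq_expect l f g : f =1 g -> expect l f = expect l g.
Proof. by move=> fg; apply: eq_bigr => p _; rewrite fg. Qed.

Lemma expectD l f g : expect l (fun x => f x + g x) = expect l f + expect l g.
Proof. by rewrite -big_split /=; apply: eq_bigr => p _; rewrite mulrDr. Qed.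

Lemma expectZ l c f : expect l (fun x => c * f x) = c * expect l f.
Proof. by rewrite /expect mulr_sumr; apply: eq_bigr => p _; rewrite mulrCA. Qed.

Lemma expectB l f g : expect l (fun x => f x - g x) = expect l f - expect l g.
Proof.
by rewrite -sumrB /=; apply: eq_bigr => p _; rewrite mulrBr.
Qed.

Lemma expect_sum (I : Type) (r : seq I) l (F : I -> T -> R) :
  expect l (fun x => \sum_(i <- r) F i x) = \sum_(i <- r) expect l (F i).
Proof.
by rewrite exchange_big /=; apply: eq_bigr => p _; rewrite mulr_sumr.
Qed.

Lemma expect_comm (U : eqType) l (l' : seq (R * U)) (F : T -> U -> R) :
  expect l (fun x => expect l' (F x)) =
  expect l' (fun y => expect l (fun x => F x y)).
Proof.
rewrite /expect (eq_bigr _ (fun p _ => mulr_sumr _ _ _ _)) exchange_big /=.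
apply: eq_bigr => q _; rewrite mulr_sumr.
by apply: eq_bigr => p _; rewrite mulrCA.
Qed.

Variables (l : seq (R * T)) (lP : is_law l).

Lemma expect_le f g : (forall x, f x <= g x) -> expect l f <= expect l g.
Proof.
move=> fg; rewrite /expect big_seq [leRHS]big_seq.
by apply: ler_sum => p pl; apply: ler_wpM2l => //; case: lP => + _; apply.
Qed.

Lemma expect_cst c : expect l (fun=> c) = c.
Proof. by rewrite /expect -mulr_suml; case: lP => _ ->; rewrite mul1r. Qed.

Lemma expect_ge0 f : (forall x, 0 <= f x) -> 0 <= expect l f.
Proof. by move=> f0; rewrite -(expect_cst 0); apply: expect_le. Qed.

Lemma expect_le_cst c f : (forall x, f x <= c) -> expect l f <= c.
Proof. by move=> fc; rewrite -[leRHS]expect_cst; apply: expect_le. Qed.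

Lemma expect_norm f : `|expect l f| <= expect l (fun x => `|f x|).
Proof.
rewrite ler_norml -mulN1r -expectZ.
apply/andP; split; apply: expect_le => x; last exact: ler_norm.
by rewrite mulN1r lerNl -normrN ler_norm.
Qed.

Lemma expect_dist f g :
  `|expect l f - expect l g| <= expect l (fun x => `|f x - g x|).
Proof. by rewrite -expectB; apply: expect_norm. Qed.

End Generic.

Definition law_mul (G : groupType) (l1 l2 : seq (R * G)) : seq (R * G) :=
  [seq (p.1 * q.1, (p.2 * q.2)%g) | p <- l1, q <- l2].

Lemma expect_mul (G : groupType) (l1 l2 : seq (R * G)) (f : G -> R) :
  expect (law_mul l1 l2) f =
  expect l1 (fun x => expect l2 (fun y => f (x * y)%g)).
Proof.
rewrite /expect /law_mul big_allpairs_dep /=; apply: eq_bigr => p _.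
by rewrite mulr_sumr; apply: eq_bigr => q _; rewrite mulrA.
Qed.

Lemma law_mulP (G : groupType) (l1 l2 : seq (R * G)) :
  is_law l1 -> is_law l2 -> is_law (law_mul l1 l2).
Proof.
move=> l1P l2P; split=> [p /allpairsP[[p1 p2] [p1l p2l ->]] /=|].
  by rewrite mulr_ge0//; [case: l1P|case: l2P] => + _; apply.
have := expect_mul l1 l2 (fun=> 1).
rewrite (eq_expect _ (fun x => expect_cst l2P 1)) (expect_cst l1P) => <-.
by apply: eq_bigr => p _; rewrite mulr1.
Qed.

Definition law_map (T U : Type) (h : T -> U) (l : seq (R * T)) : seq (R * U) :=
  [seq (p.1, h p.2) | p <- l].

Lemma expect_map (T U : Type) (h : T -> U) l (f : U -> R) :
  expect (law_map h l) f = expect l (f \o h).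
Proof. by rewrite /expect big_map. Qed.

Lemma law_mapP (T U : eqType) (h : T -> U) l : is_law l -> is_law (law_map h l).
Proof.
move=> [l0 l1]; split; last by rewrite big_map.
by move=> p /mapP[q ql ->]; apply: l0.
Qed.

End Expectation.

(** * The lazy walk on the plane *)

Local Notation Z2 := (int * int)%type.

Definition steps : seq Z2 := [:: (0, 0); (1, 0); (-1, 0); (0, 1); (0, -1)].

Definition step_law (R : realType) (nu : Z2 -> R) : seq (R * Z2) :=
  [seq (nu a, a) | a <- steps].

(** The constant [k] bounds the weights of the five steps from below.  It is the
    only feature of [nu] on which the estimates depend; the weight of the step 0
    is what the coupling behind [gap] uses. *)
Record lazy_walk (R : realType) (nu : Z2 -> R) (k : R) : Prop := LazyWalk {
  lazy_law : is_law (step_law nu);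
  lazy_sym : symmetric_mass nu;
  lazy_gt0 : 0 < k;
  lazy_min : forall a, a \in steps -> k <= nu a }.

Section PlaneWalk.
Variables (R : realType) (nu : Z2 -> R) (k : R) (nuP : lazy_walk nu k).
Implicit Types (f g : Z2 -> R) (x y z a : Z2) (m n : nat).

Let nuL : is_law (step_law nu) := lazy_law nuP.

Lemma expect_stepsE f : expect (step_law nu) f =
  nu (0, 0) * f (0, 0) + nu (1, 0) * f (1, 0) + nu (1, 0) * f (-1, 0) +
  nu (0, 1) * f (0, 1) + nu (0, 1) * f (0, -1).
Proof.
have E1 : nu (-1, 0) = nu (1, 0) := lazy_sym nuP (1, 0).
have E2 : nu (0, -1) = nu (0, 1) := lazy_sym nuP (0, 1).
rewrite /expect /step_law /steps !big_map !big_cons big_nil /= E1 E2.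
by rewrite addr0 !addrA.
Qed.

Lemma expect_steps_opp f :
  expect (step_law nu) (fun a => f (- a)) = expect (step_law nu) f.
Proof.
rewrite !expect_stepsE.
have -> : - ((0, 0) : Z2) = (0, 0) by [].
have -> : - ((1, 0) : Z2) = (-1, 0) by [].
have -> : - ((-1, 0) : Z2) = (1, 0) by [].
have -> : - ((0, 1) : Z2) = (0, -1) by [].
have -> : - ((0, -1) : Z2) = (0, 1) by [].
by ring.
Qed.

(** [walk_pow n f z] is the expectation of [f] at time [n] for the walk started
    at [z]. *)
Definition walk_op f : Z2 -> R := fun z => expect (step_law nu) (fun a => f (z + a)).

Definition walk_pow n f : Z2 -> R := iter n walk_op f.

Lemma walk_powS n f z :
  walk_pow n.+1 f z = expect (step_law nu) (fun a => walk_pow n f (z + a)).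
Proof. by []. Qed.

Lemma walk_powSr n f : walk_pow n.+1 f = walk_pow n (walk_op f).
Proof. exact: iterSr. Qed.

Lemma walk_powD m n f : walk_pow (m + n) f = walk_pow m (walk_pow n f).
Proof. exact: iterD. Qed.

Lemma walk_pow_le n f g : (forall z, f z <= g z) ->
  forall z, walk_pow n f z <= walk_pow n g z.
Proof.
move=> fg; elim: n => [//|n IH] z.
by apply: (expect_le nuL) => a; apply: IH.
Qed.

Lemma walk_pow_cst n c z : walk_pow n (fun=> c) z = c.
Proof.
elim: n z => [//|n IH] z; rewrite walk_powS.
by rewrite (eq_expect _ (fun a => IH _)) (expect_cst nuL).
Qed.

Lemma walk_pow_ge0 n f : (forall z, 0 <= f z) -> forall z, 0 <= walk_pow n f z.
Proof.
by move=> f0 z; rewrite -(walk_pow_cst n 0 z); apply: walk_pow_le.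
Qed.

Lemma walk_pow_le_cst n c f : (forall z, f z <= c) ->
  forall z, walk_pow n f z <= c.
Proof.
by move=> fc z; rewrite -[leRHS](walk_pow_cst n c z); apply: walk_pow_le.
Qed.

Lemma walk_powMD n c f g z : walk_pow n (fun x => c * f x + g x) z =
  c * walk_pow n f z + walk_pow n g z.
Proof.
elim: n z => [//|n IH] z; rewrite !walk_powS -expectZ -expectD.
exact: eq_expect.
Qed.

Lemma walk_pow_sum n (I : Type) (r : seq I) (F : I -> Z2 -> R) z :
  walk_pow n (fun x => \sum_(i <- r) F i x) z =
  \sum_(i <- r) walk_pow n (F i) z.
Proof.
elim: n z => [//|n IH] z; rewrite walk_powS (eq_expect _ (fun a => IH _)).
exact: expect_sum.
Qed.

Lemma walk_pow_shift n f y z :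
  walk_pow n (fun x => f (x + y)) z = walk_pow n f (z + y).
Proof.
elim: n z => [//|n IH] z; rewrite !walk_powS.
by apply: eq_expect => a; rewrite IH addrAC.
Qed.

Lemma walk_pow_opp n f z : walk_pow n (fun x => f (- x)) z = walk_pow n f (- z).
Proof.
elim: n z => [//|n IH] z; rewrite !walk_powS -[RHS]expect_steps_opp.
by apply: eq_expect => a; rewrite IH opprD.
Qed.

Lemma walk_pow_dist n f g z :
  `|walk_pow n f z - walk_pow n g z| <= walk_pow n (fun x => `|f x - g x|) z.
Proof.
elim: n z => [//|n IH] z; rewrite !walk_powS.
apply: le_trans (expect_dist nuL _ _) _.
by apply: (expect_le nuL) => a; apply: IH.
Qed.

Definition sqlen z : R := z.1%:~R ^+ 2 + z.2%:~R ^+ 2.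

Lemma sqlen_ge0 z : 0 <= sqlen z.
Proof. by rewrite addr_ge0 // sqr_ge0. Qed.

Lemma sum_nuE : nu (0, 0) + nu (1, 0) *+ 2 + nu (0, 1) *+ 2 = 1.
Proof. by have := expect_cst nuL 1; rewrite expect_stepsE => <-; ring. Qed.

Lemma nu_gek : [/\ k <= nu (0, 0), k <= nu (1, 0) & k <= nu (0, 1)].
Proof. by split; apply: (lazy_min nuP); rewrite !inE. Qed.

Lemma sqlen_step z : expect (step_law nu) (fun a => sqlen (z + a)) <= sqlen z + 1.
Proof.
have [k0 k1 k2] := nu_gek; have kgt0 := lazy_gt0 nuP; have S := sum_nuE.
rewrite expect_stepsE /sqlen /= !intrD !addr0 ?rmorphN1 ?mulrN1z.
set X := _%:~R; set Y := _%:~R; rewrite mulr1z.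
rewrite [leLHS](_ : _ = (nu (0, 0) + nu (1, 0) *+ 2 + nu (0, 1) *+ 2) *
  (X ^+ 2 + Y ^+ 2) + (nu (1, 0) *+ 2 + nu (0, 1) *+ 2)); last by ring.
rewrite S; lra.
Qed.

Lemma sqlen_walk n z : walk_pow n sqlen z <= sqlen z + n%:R.
Proof.
elim: n z => [|n IH] z; first by rewrite addr0.
rewrite walk_powSr; apply: le_trans (walk_pow_le n sqlen_step z) _.
have := walk_powMD n 1 sqlen (fun=> 1) z; rewrite walk_pow_cst mul1r.
rewrite (_ : (fun x => 1 * sqlen x + 1) = (fun z0 => sqlen z0 + 1)); last first.
  by apply/funext => x; rewrite mul1r.
by move=> ->; rewrite -natr1 addrA lerD2r.
Qed.

End PlaneWalk.

(** * Loss of memory of the starting point *)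

Section Smoothing.
Variables (R : realType) (nu : Z2 -> R) (k : R) (nuP : lazy_walk nu k).
Implicit Types (f g : Z2 -> R) (x y z a : Z2) (m n d : nat).

(** Probability that two coupled walkers at distance [d] along an axis have not
    met by time [m].  With probability [k] only the first takes the unit step
    along the axis, with probability [k] only the second does, while the other
    rests; in the remaining cases they move together.  The distance is then a
    lazy symmetric walk absorbed at 0. *)
Fixpoint gap m d : R :=
  match m, d with
  | 0, _ => (0 < d)%N%:R
  | _.+1, 0 => 0
  | m'.+1, d'.+1 =>
      k * gap m' d' + k * gap m' d'.+2 + (1 - k *+ 2) * gap m' d'.+1
  end.

Lemma lazy_small : 0 <= 1 - k *+ 2.
Proof.
have [k0 k1 k2] := nu_gek nuP; have kgt0 := lazy_gt0 nuP.
have := sum_nuE nuP; lra.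
Qed.

Lemma gap0 m : gap m 0 = 0. Proof. by case: m. Qed.

Lemma gapS m d : gap m.+1 d.+1 =
  k * gap m d + k * gap m d.+2 + (1 - k *+ 2) * gap m d.+1.
Proof. by []. Qed.

Lemma gap_noninc m d : gap m.+1 d <= gap m d.
Proof.
have kgt0 := ltW (lazy_gt0 nuP); have k2 := lazy_small.
elim: m d => [|m IH] [|d] //.
  by rewrite /=; case: d => [|d] /=; lra.
rewrite (gapS m.+1) [leRHS]gapS.
by apply: lerD; [apply: lerD|]; apply: ler_wpM2l => //; apply: IH.
Qed.

Lemma gap_le1 m d : gap m d <= 1.
Proof.
by elim: m => [|m IH]; [case: d|exact: le_trans (gap_noninc _ _) IH].
Qed.

(** Up to an exit from the interval from 0 to [N], the summed survival
    probability is at most the mean exit time, d (N - d)/(2 k); and [N] is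
    reached before 0 with probability d/N, which costs at most [M]. *)
Lemma sum_gap_le N M d : (0 < N)%N -> (d <= N)%N ->
  \sum_(m < M) gap m d <=
  d%:R * (N%:R - d%:R) / (k *+ 2) + M%:R * (d%:R / N%:R).
Proof.
move=> N0; have kgt0 := lazy_gt0 nuP; have k2 := lazy_small.
have Nne : N%:R != 0 :> R by rewrite pnatr_eq0 -lt0n.
have kne : k != 0 by rewrite gt_eqF.
elim: M d => [|M IH] d dN.
  rewrite big_ord0 mul0r addr0; apply: divr_ge0; last by lra.
  by rewrite mulr_ge0 // subr_ge0 ler_nat.
case: d dN => [|d] dN.
  by rewrite !mul0r mulr0 addr0 big1 // => i _; rewrite gap0.
have [dE|dN'] := eqVneq d.+1 N.
  rewrite -dE subrr mulr0 mul0r add0r divff ?mulr1; last by rewrite dE.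
  rewrite -[M.+1 in leRHS]card_ord -sumr_const.
  by apply: ler_sum => i _; apply: gap_le1.
have dN2 : (d.+2 <= N)%N by rewrite ltn_neqAle dN' dN.
rewrite big_ord_recl [X in _ + X](eq_bigr (fun m : 'I_M =>
   k * gap m d + k * gap m d.+2 + (1 - k *+ 2) * gap m d.+1)) //.
rewrite !big_split -!mulr_sumr [gap _ _]/=.
have I1 := ler_wpM2l (ltW kgt0) (IH d (ltnW (ltnW dN2))).
have I2 := ler_wpM2l (ltW kgt0) (IH d.+2 dN2).
have I3 := ler_wpM2l k2 (IH d.+1 dN).
apply: le_trans (lerD (lexx 1) (lerD (lerD I1 I2) I3)) _.
rewrite -subr_ge0 [X in 0 <= X](_ : _ = d.+1%:R / N%:R) ?divr_ge0 //.
have E1 : d.+2%:R = d%:R + 2 :> R by rewrite -[d.+2]addn2 natrD.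

rewrite E1 -!natr1.
by field; apply/andP.
Qed.

Definition smooth_cst : R := k^-1 + 1.

Lemma smooth_cst_gt0 : 0 < smooth_cst.
Proof. by rewrite addr_gt0 // invr_gt0 (lazy_gt0 nuP). Qed.

(** As [gap] decreases in time, [M * gap M d] is at most the sum bounded in
    [sum_gap_le]; for s of order sqrt M, the choice N = s balances the two
    terms. *)
Lemma gap_le M s d : (0 < s)%N -> (s ^ 2 <= M)%N ->
  gap M d <= smooth_cst * (d%:R / s%:R).
Proof.
move=> s0 sM; have kgt0 := lazy_gt0 nuP.
have sgt0 : 0 < s%:R :> R by rewrite ltr0n.
have ds0 : 0 <= d%:R / s%:R :> R by rewrite divr_ge0.
have [sd|ds] := ltnP s d.
  apply: le_trans (gap_le1 _ _) _.
  have h : 1 <= d%:R / s%:R :> R by rewrite ler_pdivlMr // mul1r ler_nat ltnW.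
  apply: le_trans h _; rewrite ler_peMl // /smooth_cst lerDr.
  by rewrite invr_ge0 ltW.
have M0 : 0 < M%:R :> R by rewrite ltr0n (leq_trans _ sM) // expn_gt0 s0.
have le_sum : M%:R * gap M d <= \sum_(m < M) gap m d.
  rewrite mulr_natl -[X in _ *+ X]card_ord -sumr_const.
  apply: ler_sum => i _.
  suff: forall j, gap (j + i) d <= gap i d.
    by move=> /(_ (M - i)%N); rewrite subnK // ltnW.
  by elim=> [//|j IHj]; apply: le_trans (gap_noninc _ _) IHj.
rewrite -(ler_pM2l M0); apply: le_trans le_sum _.
apply: le_trans (sum_gap_le M s0 ds) _.
rewrite /smooth_cst mulrDl mul1r [leRHS]mulrDr lerD2r.
have -> : M%:R * (k^-1 * (d%:R / s%:R)) = (M%:R / s%:R) * (d%:R / k) :> R by ring.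
have h1 : s%:R <= M%:R / s%:R :> R.
  by rewrite ler_pdivlMr // -natrM ler_nat mulnn.
have -> : d%:R * (s%:R - d%:R) / (k *+ 2) = ((s%:R - d%:R) / 2) * (d%:R / k) :> R.
  by field; rewrite gt_eqF.
apply: ler_wpM2r; first by rewrite divr_ge0 // ltW.
have := ler0n R d; lra.
Qed.

Lemma walk_gap f m d z e : (forall x y, f x - f y <= 1) ->
  e = (1, 0) \/ e = (0, 1) ->
  `|walk_pow nu m f (z + e *+ d) - walk_pow nu m f z| <= gap m d.
Proof.
move=> fosc eE; elim: m d z => [|m IH] d z.
  case: d => [|d]; first by rewrite mulr0n addr0 subrr normr0.
  by rewrite ler_norml /= fosc lerNl opprB fosc.
case: d => [|d]; first by rewrite mulr0n addr0 subrr normr0.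
rewrite !walk_powS; set u := walk_pow nu m f in IH *.
pose U a := u (z + e *+ d.+1 + a); pose V a := u (z + a).
have UV a : `|U a - V a| <= gap m d.+1 by rewrite /U addrAC; apply: IH.
have UV1 : `|U 0 - V e| <= gap m d.
  by have := IH d (z + e); rewrite -addrA -mulrS /U addr0.
have UV2 : `|U e - V 0| <= gap m d.+2.
  by have := IH d.+2 z; rewrite /U /V addr0 -addrA -mulrSr.
change (`|expect (step_law nu) U - expect (step_law nu) V| <= gap m.+1 d.+1).
rewrite !(expect_stepsE nuP) gapS.
have [k0 k1 k2] := nu_gek nuP; have kgt0 := lazy_gt0 nuP; have S := sum_nuE nuP.
(* The weights of [0] and [e] are split as [k] plus a remainder: the parts [k]
   are paired crosswise, which gives [UV1] and [UV2], and all the rest is paired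
   step by step, which gives [UV]. *)
have W c a : 0 <= c -> - (c * gap m d.+1) <= c * (U a - V a) <= c * gap m d.+1.
  move=> c0; have := UV a; rewrite ler_norml => /andP[h1 h2].
  by rewrite -mulrN !ler_wpM2l.
have W1 : - (k * gap m d) <= k * (U 0 - V e) <= k * gap m d.
  move: UV1; rewrite ler_norml => /andP[h1 h2].
  by rewrite -mulrN !ler_wpM2l // ltW.
have W2 : - (k * gap m d.+2) <= k * (U e - V 0) <= k * gap m d.+2.
  move: UV2; rewrite ler_norml => /andP[h1 h2].
  by rewrite -mulrN !ler_wpM2l // ltW.
have Sg : nu (0, 0) * gap m d.+1 = gap m d.+1 -
   nu (1, 0) * gap m d.+1 *+ 2 - nu (0, 1) * gap m d.+1 *+ 2.
  by rewrite -[X in _ = X - _ - _]mul1r -S; ring.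
have w0 := W (nu (0, 0) - k) (0, 0) ltac:(lra).
have e1 := W (nu (1, 0)) (1, 0) ltac:(lra).
have e1k := W (nu (1, 0) - k) (1, 0) ltac:(lra).
have e2 := W (nu (1, 0)) (-1, 0) ltac:(lra).
have e3 := W (nu (0, 1)) (0, 1) ltac:(lra).
have e3k := W (nu (0, 1) - k) (0, 1) ltac:(lra).
have e4 := W (nu (0, 1)) (0, -1) ltac:(lra).
move: w0 e1 e1k e2 e3 e3k e4 W1 W2 {W UV UV1 UV2}.
rewrite ler_norml -[0 : Z2]/(0, 0); case: eE => ->.
  move=> /andP[a1 a2] _ /andP[b1 b2] /andP[c1 c2] /andP[d1 d2] _ /andP[g1 g2].
  by move=> /andP[h1 h2] /andP[i1 i2]; apply/andP; split; lra.
move=> /andP[a1 a2] /andP[b1 b2] _ /andP[c1 c2] _ /andP[d1 d2] /andP[g1 g2].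
by move=> /andP[h1 h2] /andP[i1 i2]; apply/andP; split; lra.
Qed.

Definition len z : nat := (absz z.1 + absz z.2)%N.

Lemma lenD y z : (len (y + z)%R <= len y + len z)%N.
Proof. by rewrite /len /=; lia. Qed.

Lemma lenN z : len (- z) = len z.
Proof. by rewrite /len /=; lia. Qed.

(** The two coordinates of [y] are treated one after the other, with a coupling
    along the corresponding axis. *)
Lemma walk_smooth f M s y z : (forall x y, f x - f y <= 1) ->
  (0 < s)%N -> (s ^ 2 <= M)%N ->
  `|walk_pow nu M f (z + y) - walk_pow nu M f z| <=
    smooth_cst * ((len y)%:R / s%:R).
Proof.
move=> fosc s0 sM.
have dir e c x : e = (1, 0) \/ e = (0, 1) ->
    `|walk_pow nu M f (x + e *~ c) - walk_pow nu M f x| <=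
    smooth_cst * ((absz c)%:R / s%:R).
  move=> eE; case: c => [d|d].
    apply: le_trans (gap_le _ s0 sM); exact: walk_gap.
  apply: le_trans (gap_le _ s0 sM).
  have := walk_gap M d.+1 (x + e *~ (Negz d)) fosc eE.
  by rewrite distrC NegzE mulrNz subrK.
have -> : z + y = (z + ((1, 0) : Z2) *~ y.1) + ((0, 1) : Z2) *~ y.2.
  case: y z => [y1 y2] [z1 z2].
  have Fn (p : Z2) j : p *+ j = (p.1 *+ j, p.2 *+ j).
    by elim: j => [|j IHj]; rewrite ?mulr0n // !mulrS IHj.
  have F (p : Z2) (c : int) : p *~ c = (p.1 *~ c, p.2 *~ c).
    by case: c => j; rewrite /intmul Fn.
  by rewrite !F /= !intz !mul0rz; congr (_, _); rewrite /= ?addr0.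
apply: le_trans (ler_distD (walk_pow nu M f (z + ((1, 0) : Z2) *~ y.1)) _ _) _.
rewrite /len natrD [X in _ <= _ * X]mulrDl [leRHS]mulrDr [leRHS]addrC.
by apply: lerD; apply: dir; [right|left].
Qed.

End Smoothing.

(** * Hitting a ball from far away is unlikely *)

Section Hitting.
Variables (R : realType) (nu : Z2 -> R) (k : R) (nuP : lazy_walk nu k).
Implicit Types (f g : Z2 -> R) (x y z a v w : Z2) (m n : nat).

Let nuL : is_law (step_law nu) := lazy_law nuP.

Definition ball (L : nat) : set Z2 := [set z | (len z <= L)%N].

Fixpoint hit n (K : set Z2) v : R :=
  if `[< K v >] then 1 else
  if n is n'.+1 then expect (step_law nu) (fun a => hit n' K (v + a)) else 0.

Definition green T f v : R := \sum_(t < T) walk_pow nu t f v.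

Lemma greenS_ge T f v : (forall w, 0 <= f w) ->
  expect (step_law nu) (fun a => green T f (v + a)) <= green T.+1 f v.
Proof.
move=> f0; rewrite /green expect_sum big_ord_recl /= -[leLHS]add0r.
by apply: lerD.
Qed.

Lemma green_le S T f v : (forall w, 0 <= f w) -> (S <= T)%N ->
  green S f v <= green T f v.
Proof.
move=> f0 ST; rewrite /green (big_ord_widen T (fun t => walk_pow nu t f v)) //.
rewrite [leRHS](bigID (fun i : 'I_T => (i < S)%N)) /= lerDl sumr_ge0 // => i _.
exact: (walk_pow_ge0 nuP).
Qed.

(** First-entrance inequality: a walk that enters [K] within [n] steps then
    collects at least [g] within the next [T] steps. *)
Lemma hit_green T n (K : set Z2) f (g : R) v : (forall w, 0 <= f w) -> 0 <= g ->
  (forall w, K w -> g <= green T f w) -> hit n K v * g <= green (T + n) f v.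
Proof.
move=> f0 g0 Kg; elim: n v => [|n IH] v /=; case: asboolP => Kv.
- by rewrite mul1r addn0 Kg.
- by rewrite mul0r sumr_ge0 // => i _; apply: (walk_pow_ge0 nuP).
- by rewrite mul1r (le_trans (Kg _ Kv)) // green_le // leq_addr.
rewrite mulrC -expectZ addnS; apply: le_trans (greenS_ge _ _ f0).
by apply: (expect_le nuL) => a; rewrite mulrC.
Qed.

(** The counting measure is invariant under the walk. *)
Lemma sum_walk_le n f S :
  (forall V : seq Z2, uniq V -> \sum_(v <- V) f v <= S) ->
  forall V : seq Z2, uniq V -> \sum_(v <- V) walk_pow nu n f v <= S.
Proof.
move=> fS; elim: n => [//|n IH] V uV.
rewrite -(expect_sum V (step_law nu) (fun v a => walk_pow nu n f (v + a))).
apply: (expect_le_cst nuL) => a.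
rewrite -(big_map (fun v => v + a) xpredT (walk_pow nu n f)).
by apply: IH; rewrite map_inj_uniq //; apply: addIr.
Qed.

Definition int_range (m n : nat) : seq int := [seq (i%:Z - m%:Z)%R | i <- iota 0 n].

Lemma mem_int_range m n (c : int) :
  (c \in int_range m n) = (- m%:Z <= c) && (c < n%:Z - m%:Z).
Proof.
apply/mapP/andP => [[i]|[c1 c2]].
  by rewrite mem_iota => ic ->; split; lia.
by exists (absz (c + m%:Z)); [rewrite mem_iota; lia|lia].
Qed.

Definition int_box m n : seq Z2 := [seq (i, j) | i <- int_range m n, j <- int_range m n].

Lemma size_int_box m n : size (int_box m n) = (n ^ 2)%N.
Proof. by rewrite size_allpairs !size_map size_iota mulnn. Qed.

Lemma int_box_uniq m n : uniq (int_box m n).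
Proof.
have u : uniq (int_range m n).
  by rewrite map_inj_uniq ?iota_uniq // => i j /addIr[].
by apply: allpairs_uniq => // -[i j] [i' j'] _ _ [-> ->].
Qed.

Lemma mem_int_box m n z :
  (z \in int_box m n) = (z.1 \in int_range m n) && (z.2 \in int_range m n).
Proof.
case: z => i j; apply/allpairsP/andP => [[[i' j'] [? ? [-> ->]]]|[? ?]] //.
by exists (i, j).
Qed.

Lemma sum_indic (T : Type) (V : seq T) (b : pred T) :
  \sum_(v <- V) (b v)%:R = (count b V)%:R :> R.
Proof. by elim: V => [|v V IH]; rewrite ?big_nil // big_cons IH -natrD. Qed.

Lemma card_ball L (V : seq Z2) : uniq V ->
  \sum_(v <- V) (len v <= L)%N%:R <= ((L.*2.+1) ^ 2)%N%:R :> R.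
Proof.
move=> uV; rewrite (sum_indic V (fun v => len v <= L)%N) ler_nat -size_filter.
rewrite -(size_int_box L); apply: uniq_leq_size; first exact: filter_uniq.
move=> z; rewrite mem_filter mem_int_box !mem_int_range => /andP[+ _].
by rewrite /len; lia.
Qed.

(** Cut the plane into squares of side [l].  By Chebyshev's inequality the
    walk at time [n] is with probability at least 1/2 in one of the 4 m^2 squares
    next to the origin, so two independent copies of it are in the same square
    with probability at least 1/(16 m^2).  By symmetry, the difference of the
    copies has the law of the walk at time 2 n, and two points of a square are
    less than 2 l apart. *)
Lemma heat_kernel_ge l m n : (0 < l)%N -> (0 < m)%N ->
  (n.*2 <= m ^ 2 * l ^ 2)%N ->
  ((16 * m ^ 2)%N%:R)^-1 <=
  walk_pow nu (n + n) (fun x => (len x <= l.*2)%N%:R) 0.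
Proof.
move=> l0 m0 nml.
pose idx z : Z2 := ((z.1 %/ l%:Z)%Z, (z.2 %/ l%:Z)%Z).
pose p j := walk_pow nu n (fun x => (idx x == j)%:R) 0.
pose J := int_box m m.*2.
have ml0 : 0 < (m ^ 2 * l ^ 2)%N%:R :> R by rewrite ltr0n muln_gt0 !expn_gt0 m0 l0.
have sump : 1 / 2 <= \sum_(j <- J) p j.
  (* Off the 4 m^2 squares the squared length is at least (m l)^2. *)
  rewrite -walk_pow_sum.
  have lb x : 1 - ((m ^ 2 * l ^ 2)%N%:R)^-1 * sqlen R x
              <= \sum_(j <- J) (idx x == j)%:R.
    have -> : \sum_(j <- J) (idx x == j)%:R = (idx x \in J)%:R :> R.
      rewrite sum_indic -count_uniq_mem ?int_box_uniq //.
      by congr _%:R; apply: eq_count => j; rewrite /= eq_sym.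
    have [xJ|xJ] := boolP (idx x \in J).
      by rewrite gerBl mulr_ge0 // ?invr_ge0 ?ler0n ?sqlen_ge0.
    rewrite subr_le0 ler_pdivlMl // mulr1.
    have : (m ^ 2 * l ^ 2)%N%:Z <= x.1 ^+ 2 + x.2 ^+ 2.
      have key (c : int) : (c %/ l%:Z)%Z \notin int_range m m.*2 ->
          (m ^ 2 * l ^ 2)%N%:Z <= c ^+ 2.
        rewrite mem_int_range => h.
        have : (m%:Z * l%:Z <= c) || (c <= - (m%:Z * l%:Z)).
          have cE := divz_eq c l%:Z; have r0 := modz_ge0 c (_ : l%:Z != 0).
          have r1 := ltz_pmod c (_ : 0 < l%:Z).
          have {}r0 := r0 ltac:(lia); have {}r1 := r1 ltac:(lia).
          move: h; set q := (c %/ _)%Z in cE *; set r := (c %% _)%Z in cE r0 r1.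
          move=> h; have {h}[h|h] : q < - m%:Z \/ m%:Z <= q by lia.
            by apply/orP; right; nia.
          by apply/orP; left; nia.
        have -> : (m ^ 2 * l ^ 2)%N%:Z = (m%:Z * l%:Z) ^+ 2.
          by rewrite -expnMn -mulnn !PoszM expr2.
        by nia.
      move: xJ; rewrite mem_int_box negb_and => /orP[] /key; nia.
    rewrite -(ler_int R) => h; apply: le_trans h _.
    by rewrite /sqlen -!rmorphXn -rmorphD.
  have := walk_pow_le nuP n lb 0.
  move=> h; apply: le_trans h.
  rewrite (_ : (fun x => 1 - _ * sqlen R x) =
     (fun x => - ((m ^ 2 * l ^ 2)%N%:R)^-1 * sqlen R x + 1)); last first.
    by apply/funext => x; rewrite mulNr addrC.
  rewrite (walk_powMD nu) (walk_pow_cst nuP) mulNr.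
  have := sqlen_walk nuP n 0.
  rewrite /sqlen /= expr0n addr0 add0r => h.
  have : ((m ^ 2 * l ^ 2)%N%:R)^-1 * walk_pow nu n (sqlen R) 0 <= 1 / 2.
    rewrite ler_pdivrMl //; apply: le_trans h _.
    have : n.*2%:R <= (m ^ 2 * l ^ 2)%N%:R :> R by rewrite ler_nat.
    rewrite -muln2 natrM; lra.
  lra.
have p0 j : 0 <= p j by apply: (walk_pow_ge0 nuP).
pose B x : R := (len x <= l.*2)%N%:R.
(* Given that the first copy is at [x], it is enough that the second is in the
   square of [x]. *)
have uge x : p (idx x) <= walk_pow nu n B x.
  rewrite -[x in leRHS]add0r -walk_pow_shift /p -[0 in leLHS]oppr0 -(walk_pow_opp nuP).
  apply: (walk_pow_le nuP) => w; rewrite ler_nat.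
  have [/eqP e|//] := boolP (idx (- w) == idx x).
  have key (c d : int) : (c %/ l%:Z = d %/ l%:Z)%Z -> (absz (c - d) < l)%N.
    have cE := divz_eq c l%:Z; have dE := divz_eq d l%:Z.
    have lne : l%:Z != 0 by lia. have lgt : 0 < l%:Z by lia.
    have := modz_ge0 c lne; have := ltz_pmod c lgt.
    have := modz_ge0 d lne; have := ltz_pmod d lgt.
    set r := (c %% _)%Z in cE *; set r' := (d %% _)%Z in dE *.
    move=> ? ? ? ? qE; rewrite qE in cE; lia.
  case: e => /key e1 /key e2; rewrite lt0b /len.
  by move: e1 e2; case: (x) => x1 x2; case: (w) => w1 w2 /=; lia.
have wge : \sum_(j <- J) p j ^+ 2 <= walk_pow nu (n + n) B 0.
  rewrite walk_powD.
  have lb x : \sum_(j <- J) p j * (idx x == j)%:R <= walk_pow nu n B x.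
    apply: le_trans (uge x).
    have [xJ|xJ] := boolP (idx x \in J).
      rewrite (bigD1_seq (idx x)) ?int_box_uniq //= eqxx mulr1.
      by rewrite big1 ?addr0 // => j /negPf; rewrite eq_sym => ->; rewrite mulr0.
    rewrite big_seq big1 ?p0 // => j jJ.
    by case: eqP => [e|_]; [rewrite e jJ in xJ|rewrite mulr0].
  apply: le_trans (walk_pow_le nuP n lb 0).
  rewrite walk_pow_sum; apply: ler_sum => j _.
  have := walk_powMD nu n (p j) (fun x => (idx x == j)%:R) (fun=> 0) 0.
  rewrite (walk_pow_cst nuP) addr0 => e; rewrite expr2 -[leLHS]e.
  by apply: (walk_pow_le nuP) => x; rewrite addr0.
apply: le_trans wge.
have m2 : 0 < m%:R ^+ 2 :> R by rewrite exprn_gt0 // ltr0n.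
(* Cauchy-Schwarz, in the form p^2 >= 2 p c - c^2 with c the mean value of [p]
   that would give a total of 1/2. *)
pose c : R := (8 * m%:R ^+ 2)^-1.
have c0 : 0 < c by rewrite invr_gt0 mulr_gt0.
have : \sum_(j <- J) ((p j *+ 2) * c - c ^+ 2) <= \sum_(j <- J) p j ^+ 2.
  apply: ler_sum => j _; rewrite -subr_ge0.
  by rewrite [X in 0 <= X](_ : _ = (p j - c) ^+ 2) ?sqr_ge0 //; ring.
apply: le_trans.
rewrite big_split /= -mulr_suml sumrMnl big_const_seq count_predT iter_addr_0.
rewrite size_int_box -muln2 expnMn.
apply: le_trans (_ : c - (m%:R ^+ 2 * 4) * c ^+ 2 <= _).
  rewrite natrM natrX le_eqVlt; apply/orP; left; apply/eqP.
  by rewrite /c; field; rewrite pnatr_eq0 -lt0n.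
apply: lerD; last first.
  by rewrite mulNrn lerN2 -[leLHS]mulr_natl natrM natrX.
by rewrite -[leLHS]mul1r ler_pM2r //; lra.
Qed.
End Hitting.

Section RareHitting.
Variables (R : realType) (nu : Z2 -> R) (k : R) (nuP : lazy_walk nu k).
Implicit Types (f g : Z2 -> R) (x y z a v w : Z2) (m n : nat).

Lemma sum_even_le (a : nat -> R) T : (forall t, 0 <= a t) ->
  \sum_(t < T) a (t + t)%N <= \sum_(t < T.*2) a t.
Proof.
move=> a0; elim: T => [|T IH]; first by rewrite !big_ord0.
rewrite doubleS !big_ord_recr /= addnn -addrA lerD // lerDl //.
Qed.

(** Every doubling of the space scale contributes to the expected time spent in
    the ball a further multiple of L^2: there are 3 4^i L^2 values of n
    between 4^i L^2 and 4^(i+1) L^2, and for each of them the walk is in the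
    ball at time 2 n with probability at least 4^-i/256. *)
Lemma green_ball_ge L I : (0 < L)%N ->
  I%:R * (L ^ 2)%N%:R / 128 <=
  green nu ((4 ^ I * L ^ 2).*2) (fun x => (len x <= L.*2)%N%:R) 0.
Proof.
move=> L0; pose B x : R := (len x <= L.*2)%N%:R.
have a0 t : 0 <= walk_pow nu t B 0 by apply: (walk_pow_ge0 nuP).
apply: le_trans (sum_even_le (4 ^ I * L ^ 2) a0).
elim: I => [|I IH]; first by rewrite mul0r mul0r sumr_ge0.
pose F t := walk_pow nu (t + t) B 0.
have le4 : (4 ^ I * L ^ 2 <= 4 ^ I.+1 * L ^ 2)%N by rewrite leq_mul2r leq_exp2l ?leqnSn ?orbT.
rewrite -(big_mkord xpredT F) (big_cat_nat (n := (4 ^ I * L ^ 2)%N)) //=.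
rewrite big_mkord -natr1 mulrDl mul1r mulrDl lerD //.
have lb t : (4 ^ I * L ^ 2 <= t < 4 ^ I.+1 * L ^ 2)%N -> ((256 * 4 ^ I)%N%:R)^-1 <= F t.
  move=> /andP[_ tI].
  have := @heat_kernel_ge R nu k nuP L (2 ^ I.+2) t L0 (expn_gt0 _ _).
  have -> : ((2 ^ I.+2) ^ 2 = 16 * 4 ^ I)%N.
    by rewrite -expnM mulnC expnM /= !expnS mulnA.
  rewrite mulnA; apply; move: tI; rewrite expnS; lia.
apply: le_trans (_ : \sum_(4 ^ I * L ^ 2 <= t < 4 ^ I.+1 * L ^ 2)
   ((256 * 4 ^ I)%N%:R)^-1 <= _); last first.
  exact: ler_sum_nat.
rewrite big_const_nat iter_addr_0 -[leRHS]mulr_natr.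
have -> : (4 ^ I.+1 * L ^ 2 - 4 ^ I * L ^ 2 = 3 * (4 ^ I * L ^ 2))%N.
  by rewrite expnS; lia.
have p4 : (4 ^ I)%N%:R != 0 :> R by rewrite pnatr_eq0 -lt0n expn_gt0.
move: (4 ^ I)%N p4 => q q0; move: (L ^ 2)%N => P; rewrite !natrM.
rewrite [leRHS](_ : _ = P%:R * (3 / 256)); last by field.
by apply: ler_wpM2l => //; lra.
Qed.

(** The point [v] is found by averaging over the box of side D = 2^I L.  The time
    that walks started from all points of the box spend in the ball of radius
    3 L before time T + 2 D^2 adds up to at most the number of steps times the
    size of this ball, while each walk that hits the ball of radius [L] before
    time [T] contributes at least I L^2/128 on average.  The constant 6400 is
    128 * 50, where 50 L^2 exceeds the number (6 L + 1)^2 of points in a square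
    around the larger ball. *)
Lemma hit_small L I K T : (0 < L)%N -> (0 < I)%N ->
  (T <= K * (2 ^ I * L) ^ 2)%N ->
  exists v, [/\ (len v <= (2 ^ I * L).*2)%N,
    sqlen R v <= ((2 ^ I * L) ^ 2).*2%:R &
    hit nu T (ball L) v <= (6400 * K.+2)%N%:R / I%:R].
Proof.
move=> L0 I0 TK; set D := (2 ^ I * L)%N in TK *.
set eta : R := (6400 * K.+2)%N%:R / I%:R.
pose V := int_box 0 D.
have Vlen v : v \in V -> (len v <= D.*2)%N /\ sqlen R v <= (D ^ 2).*2%:R.
  rewrite mem_int_box !mem_int_range; case: v => v1 v2 /=.
  move=> /andP[/andP[a1 a2] /andP[b1 b2]]; split; first by rewrite /len /=; lia.
  have : v1 ^+ 2 + v2 ^+ 2 <= (D ^ 2).*2%:Z.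
    rewrite -mul2n PoszM -mulnn PoszM; nia.
  by rewrite -(ler_int R) rmorphD !rmorphXn.
have [/hasP[v vV hv]|/hasPn hN] := boolP (has (fun v => hit nu T (ball L) v <= eta) V).
  by exists v; have [h1 h2] := Vlen v vV; split.
exfalso.
pose f x : R := (len x <= 3 * L)%N%:R.
pose S := ((4 ^ I * L ^ 2).*2)%N.
have SE : S = (2 * D ^ 2)%N.
  have e4 : (4 ^ I = (2 ^ I) ^ 2)%N by rewrite -expnM mulnC expnM.
  by rewrite /S /D e4 expnMn -mul2n.
have f0 w : 0 <= f w by [].
pose g := I%:R * (L ^ 2)%N%:R / 128 : R.
have g0 : 0 < g by rewrite divr_gt0 // mulr_gt0 // ltr0n // expn_gt0 L0.
have Kg w : ball L w -> g <= green nu S f w.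
  move=> wL; apply: le_trans (green_ball_ge I L0) _.
  apply: ler_sum => t _; rewrite -[w in leRHS]add0r -walk_pow_shift.
  apply: (walk_pow_le nuP) => x; rewrite ler_nat.
  have := lenD x w; move: wL; rewrite /ball /=; set a := len (x + w).
  by case: (leqP (len x) L.*2) => // h1 h2 h3; rewrite lt0b; lia.
have le1 : \sum_(v <- V) hit nu T (ball L) v * g <= \sum_(v <- V) green nu (S + T) f v.
  by apply: ler_sum => v _; apply: (hit_green nuP) => //; apply: ltW.
have le2 : \sum_(v <- V) green nu (S + T) f v <= (S + T)%N%:R * ((6 * L).+1 ^ 2)%N%:R.
  rewrite exchange_big /= -[(S + T)%N in leRHS]card_ord mulr_natl -sumr_const.
  apply: ler_sum => t _; apply: (sum_walk_le nuP) (int_box_uniq _ _) => V' uV'.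
  by apply: le_trans (card_ball R (3 * L) uV') _; rewrite ler_nat; lia.
have le3 : (D ^ 2)%N%:R * (eta * g) <= \sum_(v <- V) hit nu T (ball L) v * g.
  rewrite -(size_int_box 0 D) mulr_natl -[X in _ *+ X]count_predT.
  rewrite -iter_addr_0 -big_const_seq big_seq [leRHS]big_seq.
  apply: ler_sum => v vV; rewrite ler_pM2r // ltW //.
  by have := hN v vV; rewrite -ltNge.
have := le_trans le3 (le_trans le1 le2).
have -> : eta * g = 50 * (K.+2%:R * (L ^ 2)%N%:R).
  by rewrite /eta /g natrM; field; rewrite pnatr_eq0 -lt0n.
rewrite -!natrM ler_nat leqNgt => /negP; apply.
have D0 : (0 < D)%N by rewrite muln_gt0 expn_gt0.
rewrite SE; apply: leq_ltn_trans (leq_mul (leq_add (leqnn _) TK) (leqnn _)) _.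
rewrite -mulnDl add2n -!mulnn.
have : ((6 * L).+1 * (6 * L).+1 < 50 * (L * L))%N by nia.
by move: ((6 * L).+1 * _)%N => a h; rewrite -mulnA mulnCA mulnA -mulnA; nia.
Qed.

End RareHitting.

(** * Covering a small ball ahead of time *)

Section Covering.
Variables (R : realType) (nu : Z2 -> R) (k : R) (nuP : lazy_walk nu k).
Implicit Types (f g : Z2 -> R) (x y z a v w : Z2) (m n : nat) (K : set Z2).

Let nuL : is_law (step_law nu) := lazy_law nuP.

(** Probability that the walk fails to cover [K] in [n] steps.  The set is seen
    from the walker: the current site 0 is removed and the rest is translated by
    each step (the walker itself makes the opposite step).  This is the form in
    which the set of lamps to be erased evolves in [lamps_cost]. *)
Fixpoint miss n K : R :=
  if n is n'.+1 then
    expect (step_law nu) (fun a => miss n' [set w | K (w - a) /\ w <> a])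
  else (`[< ~ (K `<=` [set 0]) >])%:R.

(** The same probability for a walk started at [v], in fixed coordinates. *)
Definition miss_at n K v : R := miss n [set w | K (w + v)].

Lemma miss_ge0 n K : 0 <= miss n K.
Proof. by elim: n K => [|n IH] K //=; apply: (expect_ge0 nuL). Qed.

Lemma miss_le1 n K : miss n K <= 1.
Proof. by elim: n K => [|n IH] K /=; [case: asbool|apply: (expect_le_cst nuL)]. Qed.

Lemma miss_mono n K K' : K `<=` K' -> miss n K <= miss n K'.
Proof.
elim: n K K' => [|n IH] K K' KK' /=.
  rewrite ler_nat; case: asboolP => // NK; case: asboolP => // /contrapT K'0.
  by case: NK; apply: subset_trans K'0.
by apply: (expect_le nuL) => a; apply: IH => w /= [/KK'].
Qed.

Lemma miss_atE n K v : miss_at n.+1 K v =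
  expect (step_law nu) (fun a => miss n [set w | K (w + (v + a)) /\ w <> - a]).
Proof.
rewrite /miss_at /= -(expect_steps_opp nuP); apply: eq_expect => a.
congr (miss n _); apply/seteqP.
by split=> w /=; rewrite opprK -addrA [a + v]addrC.
Qed.

Lemma miss_atS_le n K v :
  miss_at n.+1 K v <= expect (step_law nu) (fun a => miss_at n K (v + a)).
Proof.
rewrite miss_atE; apply: (expect_le nuL) => a.
by apply: miss_mono => w [].
Qed.

Lemma miss_atS n K v : ~ K v ->
  miss_at n.+1 K v = expect (step_law nu) (fun a => miss_at n K (v + a)).
Proof.
move=> Kv; rewrite miss_atE; apply: eq_expect => a.
congr (miss n _); apply/seteqP; split=> w /=; first by case.
by move=> Kw; split=> // wa; apply: Kv; rewrite wa addrC addrK in Kw.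
Qed.

Lemma miss_walk_le m n K v :
  miss_at (m + n) K v <= walk_pow nu m (miss_at n K) v.
Proof.
elim: m v => [//|m IH] v; rewrite addSn walk_powS.
apply: le_trans (miss_atS_le _ _ _) _.
by apply: (expect_le nuL) => a; apply: IH.
Qed.

Lemma hit_ge0 n K v : 0 <= hit nu n K v.
Proof.
elim: n v => [|n IH] v /=; case: asboolP => // _; exact: (expect_ge0 nuL).
Qed.

Lemma hit_mono m n K v : (m <= n)%N -> hit nu m K v <= hit nu n K v.
Proof.
elim: m n v => [|m IH] [|n] v //= mn; case: asboolP => // _.
  by apply: (expect_ge0 nuL) => a; apply: hit_ge0.
by apply: (expect_le nuL) => a; apply: IH.
Qed.

(** If [K] has not been hit by time [m], it is covered from then on. *)
Lemma walk_miss_le m n K v :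
  walk_pow nu m (miss_at n K) v <= miss_at (m + n) K v + hit nu m K v.
Proof.
elim: m v => [|m IH] v; first by rewrite lerDl hit_ge0.
rewrite walk_powS /=; case: asboolP => Kv.
  apply: le_trans (_ : 1 <= _); last by rewrite lerDr miss_ge0.
  apply: (expect_le_cst nuL) => a.
  by apply: (walk_pow_le_cst nuP) => z; apply: miss_le1.
rewrite addSn miss_atS // -expectD.
by apply: (expect_le nuL) => a; apply: IH.
Qed.

Lemma miss_ge_hit n K v : K !=set0 -> 1 - hit nu n K v <= miss_at n K v.
Proof.
move=> [y Ky]; elim: n v => [|n IH] v.
  rewrite /miss_at /=; case: asboolP => Kv; first by rewrite subrr.
  rewrite subr0; case: asboolP => // /contrapT K0; exfalso.
  have : (y - v) = 0 by apply: K0; rewrite /= subrK.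
  by move=> /eqP; rewrite subr_eq0 => /eqP yv; rewrite yv in Ky.
rewrite /=; case: asboolP => Kv; first by rewrite subrr miss_ge0.
rewrite miss_atS // -[1](expect_cst nuL) -expectB.
by apply: (expect_le nuL) => a; apply: IH.
Qed.

Lemma len_le_sqlen D w : (0 < D)%N ->
  (len w)%:R <= (D.*2)%:R^-1 * sqlen R w + D%:R.
Proof.
move=> D0; have Dgt : 0 < D%:R :> R by rewrite ltr0n.
rewrite /len natrD !natr_absz.
have key (c : int) : `|c|%:~R <= (D.*2)%:R^-1 * (c%:~R ^+ 2) + D%:R / 2 :> R.
  rewrite -[X in _ * X + _](real_normK (num_real _)) intr_norm.
  set b := `|_|; rewrite -subr_ge0 -muln2 natrM.
  rewrite [X in 0 <= X](_ : _ = (D%:R * 2)^-1 * (b - D%:R) ^+ 2).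
    by rewrite mulr_ge0 ?sqr_ge0 // invr_ge0 mulr_ge0.
  by field; rewrite gt_eqF.
have := key w.1; have := key w.2; rewrite /sqlen mulrDr; lra.
Qed.

(** A walk from the point [v] of [hit_small] stays outside the ball up to time
    T = M + (s D)^2, so it covers the ball between [T] and [n].  The part of the
    walk from 0 after time (s D)^2 = T - M is compared with the part of the walk
    from [v] after time [T]: both have n - T steps left, and their starting
    points have nearly the same law. *)
Lemma miss_earlier s L M n e :
  (0 < s)%N -> (0 < L)%N ->
  let I := (6400 * (s ^ 2).+3 * s)%N in let D := (2 ^ I * L)%N in
  (M <= D ^ 2)%N -> e + s%:R^-1 < 1 ->
  (forall v, (len v <= D.*2)%N -> miss_at n (ball L) v <= e) ->
  (M < n)%N /\
  miss_at (n - M) (ball L) 0 <= e + s%:R^-1 + smooth_cst k * (3 / s%:R).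
Proof.
move=> s0 L0 I D MD es missn.
have I0 : (0 < I)%N by rewrite /I !muln_gt0 s0.
have D0 : (0 < D)%N by rewrite muln_gt0 expn_gt0.
have sgt : 0 < s%:R :> R by rewrite ltr0n.
have Dgt : 0 < D%:R :> R by rewrite ltr0n.
pose T := (M + (s * D) ^ 2)%N.
have TK : (T <= (s ^ 2).+1 * D ^ 2)%N by rewrite /T expnMn mulSn leq_add2r.
have [v [v1 v2]] := hit_small nuP L0 I0 TK.
have -> : (6400 * (s ^ 2).+3)%N%:R / I%:R = s%:R^-1 :> R.
  by rewrite /I [X in _ / X]natrM invfM mulrA divff ?mul1r // pnatr_eq0.
move=> hitT; rewrite -/D in v1 v2; clearbody D.
(* Otherwise the walk from [v] would have to cover the ball by time [T],
   without hitting it. *)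
have nT : (T < n)%N.
  rewrite ltnNge; apply/negP => nT.
  have := miss_ge_hit n v (ex_intro _ 0 (leq0n L) : ball L !=set0).
  have := hit_mono (ball L) v nT; have := missn v v1.
  move: es hitT; lra.
have MT : (M <= T)%N by rewrite leq_addr.
split; first exact: leq_ltn_trans nT.
pose psi := miss_at (n - T) (ball L).
pose u := walk_pow nu ((s * D) ^ 2) psi.
have uosc x y : psi x - psi y <= 1.
  have := miss_le1 (n - T) [set w | ball L (w + x)].
  by have := miss_ge0 (n - T) [set w | ball L (w + y)]; rewrite /psi /miss_at; lra.
have le1 : miss_at (n - M) (ball L) 0 <= u 0.
  have -> : (n - M = (s * D) ^ 2 + (n - T))%N by move: nT; rewrite /T; lia.
  exact: miss_walk_le.
have le2 : walk_pow nu M u v <= e + s%:R^-1.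
  rewrite -walk_powD; apply: le_trans (walk_miss_le _ _ _ _) _.
  by rewrite subnKC ?(ltnW nT) // lerD // missn.
(* The walk from [v] has moved, after [M <= D^2] steps, to a point at distance at
   most 3 D from 0 on average, which is small compared with s D. *)
have le3 : `|u 0 - walk_pow nu M u v| <= smooth_cst k * (3 / s%:R).
  rewrite -[u 0](walk_pow_cst nuP M (u 0) v).
  apply: le_trans (walk_pow_dist nuP _ _ _ _) _.
  pose c := smooth_cst k / (s * D)%N%:R.
  have c0 : 0 <= c by rewrite divr_ge0 // ltW // (smooth_cst_gt0 nuP).
  have lb w : `|u 0 - u w| <= c * (D.*2)%:R^-1 * sqlen R w + c * D%:R.
    have h : `|u 0 - u w| <= c * (len w)%:R.
      have := @walk_smooth R nu k nuP psi ((s * D) ^ 2) (s * D) w 0 uosc _ (leqnn _).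
      rewrite add0r distrC muln_gt0 s0 D0 => /(_ isT) h; apply: le_trans h _.
      by rewrite /c -mulrA [X in _ * X]mulrC.
    apply: le_trans h _; rewrite -mulrA -mulrDr ler_wpM2l //.
    exact: len_le_sqlen.
  apply: le_trans (walk_pow_le nuP M lb v) _.
  rewrite walk_powMD (walk_pow_cst nuP) -mulrA -mulrDr.
  have -> : smooth_cst k * (3 / s%:R) = c * (3 * D%:R) :> R.
    by rewrite /c natrM; field; rewrite !gt_eqF.
  apply: ler_wpM2l => //.
  have : (D.*2)%:R^-1 * walk_pow nu M (sqlen R) v <= 2 * D%:R.
    rewrite ler_pdivrMl ?ltr0n ?double_gt0 //.
    apply: le_trans (sqlen_walk nuP _ _) _.
    have : M%:R <= (D ^ 2)%N%:R :> R by rewrite ler_nat.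
    move: v2; rewrite -!muln2 !natrM; set d := D%:R; nra.
  lra.
move: le1 le2 le3; rewrite ler_norml => ? ? /andP[? ?]; lra.
Qed.

End Covering.

(** * The switch-walk-switch chain *)

Section LawPower.
Variables (R : realType) (G : groupType).
Implicit Types (l : seq (R * G)) (f : G -> R).

Definition law_pow l n : seq (R * G) := iter n (law_mul l) [:: (1, 1%g)].

Lemma expect_pow0 l f : expect (law_pow l 0) f = f 1%g.
Proof. by rewrite /expect big_seq1 mul1r. Qed.

Lemma expect_powS l n f : expect (law_pow l n.+1) f =
  expect l (fun x => expect (law_pow l n) (fun y => f (x * y)%g)).
Proof. exact: expect_mul. Qed.

Lemma expect_powD l m n f : expect (law_pow l (m + n)) f =
  expect (law_pow l m) (fun x => expect (law_pow l n) (fun y => f (x * y)%g)).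
Proof.
elim: m f => [|m IH] f.
  by rewrite expect_pow0; apply: eq_expect => y; rewrite mul1g.
rewrite addSn !expect_powS; apply: eq_expect => x; rewrite IH.
by apply: eq_expect => y; apply: eq_expect => z; rewrite mulgA.
Qed.

Lemma law_powP l n : is_law l -> is_law (law_pow l n).
Proof.
move=> lP; elim: n => [|n IH]; last exact: law_mulP.
by split; [move=> p; rewrite inE => /eqP -> /=|rewrite big_seq1].
Qed.

End LawPower.

Section Lamplighter.
Variables (R : realType) (nu : Z2 -> R) (k : R) (nuP : lazy_walk nu k).
Variable F : finGroupType.
Local Notation G := (wreath Z2 F).
Implicit Types (f : G -> R) (g h : G) (a w : Z2) (b : F) (m n : nat).

Let nuL : is_law (step_law nu) := lazy_law nuP.

Definition lamp_law : seq (R * G) :=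
  law_map (@lamp_embed Z2 F) [seq (#|F|%:R^-1, b) | b <- enum F].

Definition move_law : seq (R * G) :=
  law_map (@base_embed Z2 F) (step_law nu).

Definition step_switch : seq (R * G) := law_mul move_law lamp_law.

Definition switch_law : seq (R * G) := law_mul (law_mul lamp_law move_law) lamp_law.

(** Typed copies of the two projections: the carrier of [wreath Z2 F] hides the
    additive structure of the plane from rewriting. *)
Definition pos g : Z2 := g.1.

Definition lamp g (w : Z2) : F := g.2 w.

Definition lamp_supp g : set Z2 := [set w | lamp g w != 1%g].

Lemma wreath_ext g h : pos g = pos h -> lamp g =1 lamp h -> g = h.
Proof. exact: wreath_eq. Qed.

Lemma posM g h : pos (g * h)%g = pos g + pos h. Proof. by []. Qed.

Lemma posV g : pos (g^-1)%g = - pos g. Proof. by []. Qed.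

Lemma pos_lamp b : pos (lamp_embed Z2 b) = 0. Proof. by []. Qed.

Lemma pos_base a : pos (base_embed F a) = a. Proof. by []. Qed.

Lemma lampM g h w : lamp (g * h)%g w = (lamp g w * lamp h (w - pos g)%R)%g.
Proof. exact: wreath_mulE. Qed.

Lemma lampV g w : lamp (g^-1)%g w = ((lamp g (w + pos g)%R)^-1)%g.
Proof. exact: wreath_invE. Qed.

Lemma lamp_lamp b w : lamp (lamp_embed Z2 b) w = if w == 0 then b else 1%g.
Proof. by rewrite /lamp fsfun_fun inE. Qed.

Lemma lamp_base a w : lamp (base_embed F a) w = 1%g.
Proof. exact: fsfun0E. Qed.

Lemma lamp_embedM b b' :
  (lamp_embed Z2 b * lamp_embed Z2 b')%g = lamp_embed Z2 (b * b')%g.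
Proof.
apply: wreath_ext => [|w]; first by rewrite posM !pos_lamp addr0.
by rewrite lampM !lamp_lamp pos_lamp subr0; case: eqP => // _; rewrite mulg1.
Qed.

Lemma expect_lamp f : expect lamp_law f =
  \sum_(b : F) #|F|%:R^-1 * f (lamp_embed Z2 b).
Proof. by rewrite expect_map /expect big_map -big_enum /= enumT. Qed.

Lemma lamp_lawP : is_law lamp_law.
Proof.
apply: law_mapP; split=> [p /mapP[b _ ->]|]; first by rewrite invr_ge0.
rewrite big_map big_enum /= sumr_const -[LHS]mulr_natl mulfV //.
by rewrite pnatr_eq0 -lt0n; apply/card_gt0P; exists 1%g.
Qed.

Lemma move_lawP : is_law move_law.
Proof. exact: law_mapP. Qed.

Lemma step_switchP : is_law step_switch.
Proof. by apply: law_mulP; [apply: move_lawP|apply: lamp_lawP]. Qed.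

Lemma switch_lawP : is_law switch_law.
Proof.
by apply: law_mulP lamp_lawP; apply: law_mulP; [apply: lamp_lawP|apply: move_lawP].
Qed.

Lemma expect_lampMr b f :
  expect lamp_law (fun u => f (u * lamp_embed Z2 b)%g) = expect lamp_law f.
Proof.
rewrite !expect_lamp [RHS](reindex_inj (mulIg b)) /=.
by apply: eq_bigr => b' _; rewrite lamp_embedM.
Qed.

Lemma expect_lampMl b f :
  expect lamp_law (fun u => f (lamp_embed Z2 b * u)%g) = expect lamp_law f.
Proof.
rewrite !expect_lamp [RHS](reindex_inj (mulgI b)) /=.
by apply: eq_bigr => b' _; rewrite lamp_embedM.
Qed.

Lemma expect_lamp_idem f :
  expect lamp_law (fun u => expect lamp_law (fun u' => f (u * u')%g)) =
  expect lamp_law f.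
Proof.
rewrite -[RHS](expect_cst lamp_lawP) [LHS]expect_lamp [RHS]expect_lamp.
by apply: eq_bigr => b _; rewrite expect_lampMl.
Qed.

Lemma expect_move f :
  expect move_law f = expect (step_law nu) (fun a => f (base_embed F a)).
Proof. exact: expect_map. Qed.

Lemma expect_step_switch f : expect step_switch f =
  expect (step_law nu) (fun a => expect lamp_law (fun u => f (base_embed F a * u)%g)).
Proof. by rewrite expect_mul expect_move. Qed.

(** One switch followed by [n] rounds of move and switch.  Two consecutive
    switches at the same site amount to one, so this is the law of the walk for
    n > 0; for n = 0 it still randomizes the lamp at the origin, which starts the
    induction of [lamps_cost]. *)
Definition chain_law n : seq (R * G) := law_mul lamp_law (law_pow step_switch n).

Lemma chain_lawP n : is_law (chain_law n).
Proof.
by apply: law_mulP; [apply: lamp_lawP|apply: law_powP; apply: step_switchP].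
Qed.

Lemma switch_powE n f :
  expect (law_pow switch_law n.+1) f = expect (chain_law n.+1) f.
Proof.
elim: n f => [|n IH] f.
  rewrite /chain_law [RHS]expect_mul expect_powS expect_mul expect_mul.
  apply: eq_expect => u; rewrite expect_powS expect_mul.
  apply: eq_expect => s; apply: eq_expect => v.
  by rewrite !expect_pow0 !mulgA.
rewrite expect_powS (eq_expect _ (fun x => IH (fun y => f (x * y)%g))).
rewrite expect_mul expect_mul [RHS]expect_mul.
apply: eq_expect => u; rewrite [RHS]expect_powS [RHS]expect_mul.
apply: eq_expect => s.
rewrite -[RHS]expect_lamp_idem; apply: eq_expect => v.
rewrite expect_mul; apply: eq_expect => v'; apply: eq_expect => h.
by rewrite !mulgA.
Qed.

Lemma expect_chainD m n f : expect (chain_law (m + n)) f =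
  expect (chain_law m) (fun x => expect (law_pow step_switch n) (fun y => f (x * y)%g)).
Proof.
rewrite !expect_mul; apply: eq_expect => u; rewrite expect_powD.
by apply: eq_expect => x; apply: eq_expect => y; rewrite mulgA.
Qed.

Lemma lamps_near0 g : pos g = 0 -> lamp_supp g `<=` [set 0] ->
  g = lamp_embed Z2 (lamp g 0).
Proof.
move=> g1 g0; apply: wreath_ext => // w; rewrite lamp_lamp.
case: eqP => [->//|/eqP w0]; apply/eqP/negPn/negP => /g0 /= wE.
by rewrite wE eqxx in w0.
Qed.

Lemma lamp_comm b g : pos g = 0 -> lamp g 0 = 1%g ->
  (lamp_embed Z2 b * g = g * lamp_embed Z2 b)%g.
Proof.
move=> g1 g0; apply: wreath_ext => [|w]; first by rewrite !posM addrC.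
rewrite !lampM g1 pos_lamp !subr0 !lamp_lamp.
by case: eqP => [->|_]; rewrite ?g0 !(mulg1, mul1g).
Qed.

Definition unit_valued f := forall g, 0 <= f g <= 1.

Lemma expect_unit (T : eqType) (l : seq (R * T)) (f : T -> R) : is_law l ->
  (forall x, 0 <= f x <= 1) -> 0 <= expect l f <= 1.
Proof.
move=> lP f01; apply/andP; split.
  by apply: (expect_ge0 lP) => x; case/andP: (f01 x).
by apply: (expect_le_cst lP) => x; case/andP: (f01 x).
Qed.

(** The last step is a move [a] followed by a switch.  The switch absorbs the
    lamp of [g] at the cursor, and commutes with the other lamps of [g], which
    the move conjugates to their translates by [a].  What remains is the same
    statement for one step less, with these lamps. *)
Lemma lamps_cost n f g : unit_valued f -> pos g = 0 ->
  `|expect (chain_law n) (fun h => f (h * g)%g) - expect (chain_law n) f| <=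
  miss nu n (lamp_supp g).
Proof.
elim: n f g => [|n IH] f g f01 g1.
  rewrite /=; case: asboolP => [_|/contrapT g0].
    have /andP[? ?] := expect_unit (chain_lawP 0) f01.
    have /andP[? ?] : 0 <= expect (chain_law 0) (fun h => f (h * g)%g) <= 1.
      exact: expect_unit (chain_lawP 0) _.
    by rewrite ler_norml mulr1n; apply/andP; split; lra.
  have E0 f' : expect (chain_law 0) f' = expect lamp_law f'.
    by rewrite expect_mul; apply: eq_expect => x; rewrite expect_pow0 mulg1.
  by rewrite !E0 (lamps_near0 g1 g0) (expect_lampMr (lamp g 0) f) subrr normr0.
(* [g'] is [g] without its lamp at the cursor, [ga a] is its translate, and
   [fa a] averages [f] over the last switch, after the move [a]. *)
pose g' := ((lamp_embed Z2 (lamp g 0))^-1 * g)%g.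
have g'1 : pos g' = 0 by rewrite posM posV pos_lamp oppr0 g1 addr0.
have g'E w : lamp g' w = if w == 0 then 1%g else lamp g w.
  rewrite lampM lampV posV pos_lamp lamp_lamp !(oppr0, subr0, addr0).
  by case: eqP => [->|_]; rewrite ?mulVg // invg1 mul1g.
have gE : g = (lamp_embed Z2 (lamp g 0) * g')%g by rewrite mulKVg.
clearbody g'.
pose ga a := (base_embed F a * g' * (base_embed F a)^-1)%g.
have ga1 a : pos (ga a) = 0 by rewrite !posM g'1 posV pos_base addr0 subrr.
have gaE a w : lamp (ga a) w = if w == a then 1%g else lamp g (w - a).
  by rewrite !lampM lampV !lamp_base pos_base invg1 mulg1 mul1g g'E subr_eq0.
pose fa a h := expect lamp_law (fun u => f (h * base_embed F a * u)%g).
have fa01 a : unit_valued (fa a) by move=> h; apply: expect_unit lamp_lawP _.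
rewrite -addn1 !expect_chainD.
have E1 f' : (fun x => expect (law_pow step_switch 1) (fun y => f' (x * y)%g)) =
    (fun x => expect (step_law nu) (fun a => expect lamp_law
       (fun u => f' (x * base_embed F a * u)%g))).
  apply/funext => x; rewrite expect_powS expect_step_switch.
  apply: eq_expect => a; apply: eq_expect => u.
  by rewrite expect_pow0 mulg1 mulgA.
rewrite (E1 f) (E1 (fun h => f (h * g)%g)).
have E2 x a : expect lamp_law (fun u => f (x * base_embed F a * u * g)%g) =
    fa a (x * ga a)%g.
  rewrite /fa gE.
  have -> : (x * ga a * base_embed F a = x * base_embed F a * g')%g.
    by rewrite /ga !mulgA mulgKV.
  rewrite -[RHS](expect_lampMr (lamp g 0)) !expect_lamp.
  apply: eq_bigr => b _; congr (_ * f _).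
  rewrite lamp_embedM -[RHS]mulgA -(lamp_comm _ g'1) ?g'E ?eqxx //.
  by rewrite -lamp_embedM !mulgA.
rewrite (eq_expect _ (_ : _ =1 (fun x =>
  expect (step_law nu) (fun a => fa a (x * ga a)%g)))); last first.
  by move=> x; apply: eq_expect => a; apply: E2.
rewrite !(expect_comm (chain_law n)) addn1 /=.
apply: le_trans (expect_dist nuL _ _) _.
apply: (expect_le nuL) => a.
apply: le_trans (IH (fa a) (ga a) (fa01 a) (ga1 a)) _.
apply: (miss_mono nuP) => w /=; rewrite /lamp_supp /= gaE.
case: (w =P a) => [_|wa h]; first by rewrite eqxx.
by split=> //; exact: h.
Qed.

(** Kolmogorov's maximal inequality: the lamps can only leave the ball when the
    cursor does, and from a cursor outside the ball the bound is at least 1,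
    because the squared Euclidean length is at least half the square of [len]. *)
Lemma exit_le L M g : (0 < L)%N -> lamp_supp g `<=` ball L ->
  expect (law_pow step_switch M)
    (fun h => (`[< ~ (lamp_supp (g * h)%g `<=` ball L) >])%:R) <=
  2 / (L ^ 2)%N%:R * (sqlen R (pos g) + M%:R).
Proof.
move=> L0; have Lgt : 0 < (L ^ 2)%N%:R :> R by rewrite ltr0n expn_gt0 L0.
have c0 : 0 <= 2 / (L ^ 2)%N%:R :> R by rewrite divr_ge0.
elim: M g => [|M IH] g gL.
  rewrite expect_pow0 mulg1; case: asboolP => // _.
  by rewrite mulr_ge0 // addr0 sqlen_ge0.
rewrite expect_powS expect_step_switch.
apply: le_trans (_ : expect (step_law nu) (fun a => 2 / (L ^ 2)%N%:R *
   (sqlen R (pos g + a) + M%:R)) <= _); last first.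
  rewrite expectZ ler_wpM2l // expectD (expect_cst nuL) -natr1.
  by rewrite [M%:R + 1]addrC addrA lerD2r (sqlen_step nuP).
apply: (expect_le nuL) => a.
have [aL|La] := leqP (len (pos g + a)) L.
  rewrite expect_lamp -[leRHS](expect_cst lamp_lawP) expect_lamp.
  apply: ler_sum => b _; rewrite ler_wpM2l //.
  set y := (base_embed F a * lamp_embed Z2 b)%g.
  have yE : pos (g * y)%g = pos g + a by rewrite !posM pos_base pos_lamp addr0.
  rewrite (eq_expect _ (_ : _ =1 (fun h =>
    (`[< ~ (lamp_supp (g * y * h)%g `<=` ball L) >])%:R))); last first.
    by move=> h; rewrite mulgA.
  rewrite -yE; apply: IH => w; rewrite /lamp_supp /= lampM /y lampM lamp_base mul1g.
  rewrite pos_base lamp_lamp; case: (w - pos g - a =P 0) => [e _|_]; last first.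
    by rewrite mulg1; apply: gL.
  rewrite /ball /= (_ : w = pos g + a) //.
  by move/eqP: e; rewrite !subr_eq0 subr_eq addrC => /eqP.
apply: le_trans (_ : 1 <= _).
  apply: (expect_le_cst lamp_lawP) => u.
  by apply: (expect_le_cst (law_powP M step_switchP)) => h; case: asbool.
rewrite mulrAC ler_pdivlMr // mul1r.
have : (L ^ 2)%N%:R <= 2 * sqlen R (pos g + a).
  have : (L ^ 2)%N%:Z <= 2 * ((pos g + a).1 ^+ 2 + (pos g + a).2 ^+ 2).
    move: La; rewrite /len -mulnn PoszM; move: (pos g + a) => [p1 p2] /=.
    rewrite -(real_normK (num_real p1)) -(real_normK (num_real p2)).
    rewrite -!abszE !expr2; move: (absz p1) (absz p2) => A B La.
    have : (L * L <= (A + B) * (A + B))%N by apply: leq_mul; exact: ltnW.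
    have : 0 <= (A%:Z - B%:Z) * (A%:Z - B%:Z) by rewrite -expr2 sqr_ge0.
    by nia.
  by rewrite -(ler_int R) intrM /sqlen -!rmorphXn -rmorphD.
by have := ler0n R M; lra.
Qed.

Lemma pos_walk M (f : Z2 -> R) z :
  expect (law_pow step_switch M) (fun h => f (z + pos h)) = walk_pow nu M f z.
Proof.
elim: M z => [|M IH] z; first by rewrite expect_pow0 addr0.
rewrite expect_powS expect_step_switch walk_powS; apply: eq_expect => a.
rewrite -[RHS](expect_cst lamp_lawP) !expect_lamp; apply: eq_bigr => b _.
congr (_ * _); rewrite -IH; apply: eq_expect => h.
by rewrite !posM pos_base pos_lamp addr0 addrA.
Qed.

Lemma base0 : base_embed F (0 : Z2) = 1%g.
Proof. by apply: wreath_ext => // w; rewrite lamp_base /lamp fsfun0E. Qed.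

Lemma strip_supp g a : lamp_supp (g * (base_embed F a)^-1)%g = lamp_supp g.
Proof.
apply/seteqP; split=> w; rewrite /lamp_supp /= lampM lampV lamp_base invg1 mulg1 //.
Qed.

(** For each outcome [h] of the last [M] steps, [lamps_cost] for the first [n]
    steps replaces [h] by a pure move; then [walk_smooth] compares the moves with
    and without the final [y]. *)
Lemma shift_cost n M L s y f : unit_valued f -> (0 < L)%N -> (0 < s)%N ->
  (s ^ 2 <= M)%N ->
  `|expect (chain_law (n + M)) (fun h => f (h * base_embed F y)%g) -
    expect (chain_law (n + M)) f| <=
  2 * (miss nu n (ball L) + 2 / (L ^ 2)%N%:R * M%:R) +
  smooth_cst k * ((len y)%:R / s%:R).
Proof.
move=> f01 L0 s0 sM.
pose psi x := expect (chain_law n) (fun g => f (g * base_embed F x)%g).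
have psi01 x : 0 <= psi x <= 1 by apply: expect_unit (chain_lawP n) _ => g.
pose E (y : Z2) := expect (chain_law (n + M)) (fun h => f (h * base_embed F y)%g).
have lP := law_powP M step_switchP.
have key y' : `|E y' - walk_pow nu M psi y'| <=
    miss nu n (ball L) + 2 / (L ^ 2)%N%:R * M%:R.
  rewrite /E expect_chainD expect_comm -pos_walk.
  apply: le_trans (expect_dist lP _ _) _.
  have lb h : `|expect (chain_law n) (fun x => f (x * h * base_embed F y')%g) -
       psi (y' + pos h)| <= miss nu n (ball L) +
       (`[< ~ (lamp_supp (1 * h)%g `<=` ball L) >])%:R.
    pose h' := (h * (base_embed F (pos h))^-1)%g.
    pose f' g := f (g * base_embed F (y' + pos h))%g.
    have bE : (base_embed F (y' + pos h) = base_embed F (pos h) * base_embed F y')%g.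
      apply: wreath_ext => [|w]; first by rewrite posM !pos_base addrC.
      by rewrite lampM !lamp_base mulg1.
    have f'01 : unit_valued f' by move=> g; apply: f01.
    have h'0 : pos h' = 0 by rewrite posM posV pos_base subrr.
    have := lamps_cost n f'01 h'0.
    rewrite /f' -/(psi _) /h' strip_supp mul1g => le1.
    have eE : expect (chain_law n) (fun x => f (x * h * base_embed F y')%g) =
      expect (chain_law n) (fun x =>
        f (x * (h * (base_embed F (pos h))^-1) * base_embed F (y' + pos h))%g).
      by apply: eq_expect => x; rewrite bE !mulgA mulgKV.
    rewrite eE; apply: le_trans le1 _.
    case: asboolP => [_|/contrapT hL].
      by apply: le_trans (miss_le1 nuP _ _) _; rewrite lerDr (miss_ge0 nuP).
    by rewrite addr0; apply: (miss_mono nuP).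
  apply: le_trans (expect_le lP lb) _.
  rewrite expectD (expect_cst lP) lerD2l.
  apply: le_trans (exit_le M L0 _) _.
    by move=> w; rewrite /lamp_supp /= /lamp fsfun0E eqxx.
  by rewrite /sqlen /= !expr0n /= addr0 add0r.
have h0 := key 0; have hy := key y.
have E0 : E 0 = expect (chain_law (n + M)) f.
  by apply: eq_expect => h; rewrite base0 mulg1.
rewrite E0 in h0; rewrite -/(E y).
have osc x x' : psi x - psi x' <= 1.
  by have /andP[? ?] := psi01 x; have /andP[? ?] := psi01 x'; lra.
have := walk_smooth nuP y 0 osc s0 sM; rewrite add0r.
move: h0 hy; rewrite !ler_norml.
by move=> /andP[? ?] /andP[? ?] /andP[? ?]; apply/andP; split; lra.
Qed.

End Lamplighter.

(** * Point masses and infinite sums *)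

Section Density.
Variable R : realType.

Definition density (T : eqType) (l : seq (R * T)) : T -> R :=
  fun x => expect l (fun y => (y == x)%:R).

Definition nonneg_weights (T : eqType) (l : seq (R * T)) :=
  forall p, p \in l -> 0 <= p.1.

Lemma density_ge0 (T : eqType) (l : seq (R * T)) x :
  nonneg_weights l -> 0 <= density l x.
Proof.
by move=> l0; rewrite /density /expect big_seq sumr_ge0 // => p pl; rewrite mulr_ge0 // l0.
Qed.

Lemma esum_density (T : choiceType) (l : seq (R * T)) (c : T -> R) (V : set T) :
  nonneg_weights l -> (forall x, 0 <= c x) ->
  (\esum_(x in V) (density l x * c x)%:E =
    (expect l (fun y => (`[< V y >])%:R * c y))%:E)%E.
Proof.
move=> + c0; elim: l => [|[r y] l IH] l0.
  rewrite esum1 /density /expect ?big_nil // => x _.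
  by rewrite big_nil mul0r.
have r0 : 0 <= r by apply: (l0 (r, y)); rewrite mem_head.
have l0' : nonneg_weights l by move=> p pl; apply: l0; rewrite inE pl orbT.
rewrite /expect big_cons -/(expect _ _) EFinD -IH //=.
have -> : (r * ((`[< V y >])%:R * c y))%:E =
    (\esum_(x in V) (r * (y == x)%:R * c x)%:E)%E :> \bar R.
  rewrite (esumID [set y]); last by move=> x _; rewrite lee_fin !mulr_ge0.
  rewrite [X in (_ + X)%E]esum1 ?adde0; last first.
    by move=> x [_ /= xy]; case: eqP => [e|_]; [rewrite e in xy|rewrite mulr0 mul0r].
  case: asboolP => Vy.
    rewrite (_ : V `&` [set y] = [set y]); last by apply/setIidPr => x ->.
    by rewrite esum_set1 ?lee_fin ?eqxx ?mulr_ge0 // mulr1 mul1r.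
  rewrite (_ : V `&` [set y] = set0) ?esum_set0 ?mul0r ?mulr0 //.
  by apply/seteqP; split => x //= [Vx xy]; apply: Vy; rewrite -xy.
rewrite -esumD; last 2 first.
- by move=> x _; rewrite lee_fin !mulr_ge0.
- by move=> x _; rewrite lee_fin mulr_ge0 // density_ge0.
by apply: eq_esum => x _; rewrite -EFinD -mulrDl /density /expect big_cons.
Qed.

Lemma mass_density (T : choiceType) (l : seq (R * T)) (V : set T) :
  nonneg_weights l ->
  mass (density l) V = (expect l (fun y => (`[< V y >])%:R))%:E.
Proof.
move=> l0; have := esum_density V l0 (fun=> ler01).
rewrite /mass; under eq_esum do rewrite mulr1.
by move=> ->; congr EFin; apply: eq_expect => y; rewrite mulr1.
Qed.

Lemma push_density (T U : choiceType) (f : T -> U) (l : seq (R * T)) :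
  nonneg_weights l -> push f (density l) = density (law_map f l).
Proof.
move=> l0; apply/funext => y; rewrite /push mass_density //=.
rewrite /density expect_map; apply: eq_expect => x /=.
by congr (nat_of_bool _)%:R; apply/asboolP/eqP.
Qed.

Lemma law_map_nonneg (T U : eqType) (f : T -> U) (l : seq (R * T)) :
  nonneg_weights l -> nonneg_weights (law_map f l).
Proof. by move=> l0 p /mapP[q ql ->]; apply: l0. Qed.

Lemma convolution_densityl (G : groupType) (l : seq (R * G)) (m : G -> R) g :
  nonneg_weights l -> (forall x, 0 <= m x) ->
  convolution (density l) m g = expect l (fun h => m (h^-1 * g)%g).
Proof.
move=> l0 m0; rewrite /convolution (esum_density _ l0) //=.
by apply: eq_expect => h; case: asboolP => // _; rewrite mul1r.
Qed.

(** The atoms of the right factor, as a function of the summation variable [h],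
    sit at the points [g * y^-1]. *)
Lemma convolution_densityr (G : groupType) (l : seq (R * G)) (m : G -> R) g :
  nonneg_weights l -> (forall x, 0 <= m x) ->
  convolution m (density l) g = expect l (fun h => m (g * h^-1)%g).
Proof.
move=> l0 m0; rewrite /convolution.
under eq_esum => h _.
  have -> : m h * density l (h^-1 * g)%g =
     density (law_map (fun y => g * y^-1)%g l) h * m h.
    rewrite mulrC; congr (_ * _); rewrite /density expect_map.
    apply: eq_expect => y /=; congr (nat_of_bool _)%:R.
    apply/eqP/eqP => [->|<-]; first by rewrite invMg invgK mulKVg.
    by rewrite invMg invgK mulgKV.
  over.
rewrite (esum_density _ (law_map_nonneg l0)) //= expect_map.
by apply: eq_expect => h /=; case: asboolP => // _; rewrite mul1r.
Qed.

Lemma law_mul_nonneg (G : groupType) (l1 l2 : seq (R * G)) :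
  nonneg_weights l1 -> nonneg_weights l2 -> nonneg_weights (law_mul l1 l2).
Proof.
move=> h1 h2 p /allpairsP[[p1 p2] [p1l p2l ->]] /=.
by apply: mulr_ge0; [apply: h1|apply: h2].
Qed.

Lemma convolution_density (G : groupType) (l1 l2 : seq (R * G)) :
  nonneg_weights l1 -> nonneg_weights l2 ->
  convolution (density l1) (density l2) = density (law_mul l1 l2).
Proof.
move=> l10 l20; apply/funext => g.
rewrite (convolution_densityl g l10); last by move=> x; apply: density_ge0.
rewrite /density expect_mul; apply: eq_expect => x; apply: eq_expect => y.
congr (nat_of_bool _)%:R; apply/eqP/eqP => [->|<-]; first by rewrite mulKVg.
by rewrite mulKg.
Qed.

Lemma conv_pow_density (G : groupType) (l : seq (R * G)) n :
  nonneg_weights l -> conv_pow (density l) n = density (law_pow l n).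
Proof.
move=> l0.
have p0 m : nonneg_weights (law_pow l m).
  elim: m => [p|m IH]; last exact: law_mul_nonneg.
  by rewrite inE => /eqP ->.
elim: n => [|n IH].
  by apply/funext => g; rewrite /density expect_pow0 eq_sym.
by rewrite /conv_pow iterS -/(conv_pow _ _) IH convolution_density.
Qed.

(** Where the ratio exceeds 1 + eps, the translated law has mass at least 1 + eps
    times that of the law, so by hypothesis this set has mass at most delta/eps;
    likewise where the ratio is below 1 - eps.  The set where the density is not
    positive has mass 0. *)
Lemma almost_invariant_mass (G : groupType) (l : seq (R * G)) (g : G)
    (eps delta : R) : is_law l -> 0 < eps ->
  (forall f : G -> R, (forall x, 0 <= f x <= 1) ->
    `|expect l (fun x => f (x * g^-1)%g) - expect l f| <= delta) ->
  1 - delta / eps *+ 2 <= expect l (fun h => (`[< 0 < density l h /\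
     `|density l (h * g)%g / density l h - 1| <= eps >])%:R).
Proof.
move=> lP eps0 inv; have l0 : nonneg_weights l := lP.1.
set m := density l.
pose V : set G := [set h | 0 < m h /\ `|m (h * g)%g / m h - 1| <= eps].
change (1 - delta / eps *+ 2 <= expect l (fun h => (`[< V h >])%:R)).
have m0 h : 0 <= m h by apply: density_ge0.
pose l' := law_map (fun x => x * g^-1)%g l.
have l'0 : nonneg_weights l' := law_map_nonneg l0.
have mE h : m (h * g)%g = density l' h.
  rewrite /m /density expect_map; apply: eq_expect => x /=.
  by congr (nat_of_bool _)%:R; apply/eqP/eqP => [->|<-]; rewrite ?mulgK ?mulgKV.
have cmp (l1 l2 : seq (R * G)) (c1 c2 : R) (W : set G) :
    nonneg_weights l1 -> nonneg_weights l2 ->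
    0 <= c1 -> 0 <= c2 ->
    (forall h, W h -> density l1 h * c1 <= density l2 h * c2) ->
    c1 * expect l1 (fun y => (`[< W y >])%:R) <=
    c2 * expect l2 (fun y => (`[< W y >])%:R).
  move=> h1 h2 c10 c20 hW; rewrite -lee_fin -!expectZ.
  have := esum_density W h1 (fun=> c10); have := esum_density W h2 (fun=> c20).
  rewrite (eq_expect l1 (fun y => mulrC c1 _)) (eq_expect l2 (fun y => mulrC c2 _)).
  move=> <- <-; apply: le_esum => h Wh; rewrite lee_fin; exact: hW.
have shift (W : set G) : `|expect l' (fun y => (`[< W y >])%:R) -
    expect l (fun y => (`[< W y >])%:R)| <= delta.
  rewrite expect_map; apply: (inv (fun y => (`[< W y >])%:R)) => x.
  by case: asbool; rewrite ?ler01 lexx.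
pose Wp : set G := [set h | 0 < m h /\ m h * (1 + eps) < m (h * g)%g].
pose Wm : set G := [set h | 0 < m h /\ m (h * g)%g < m h * (1 - eps)].
pose Wz : set G := [set h | m h <= 0].
pose P (W : set G) := expect l (fun y => (`[< W y >])%:R).
have Pp : P Wp <= delta / eps.
  rewrite ler_pdivlMr //.
  have H : (1 + eps) * P Wp <= 1 * expect l' (fun y => (`[< Wp y >])%:R).
    apply: cmp => //; first by rewrite addr_ge0 // ltW.
    by move=> h [_ /ltW]; rewrite mulr1 -mE.
  have := shift Wp; rewrite ler_norml -/(P Wp) => /andP[_]; lra.
have Pm : P Wm <= delta / eps.
  rewrite ler_pdivlMr //.
  have [e1|e1] := leP 0 (1 - eps).
    have H : 1 * expect l' (fun y => (`[< Wm y >])%:R) <= (1 - eps) * P Wm.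
      by apply: cmp => // h [_ /ltW]; rewrite mulr1 -mE.
    have := shift Wm; rewrite ler_norml -/(P Wm) => /andP[+ _]; lra.
  have -> : P Wm = 0.
    rewrite -[RHS](expect_cst lP); apply: eq_expect => h.
    case: asboolP => // -[mh mhg]; have := m0 (h * g)%g; rewrite leNgt.
    by move=> /negP[]; apply: lt_trans mhg _; rewrite pmulr_rlt0.
  by rewrite mul0r; apply: le_trans (shift Wm); apply: normr_ge0.
have Pz : P Wz <= 0.
  have := cmp l l 1 0 Wz l0 l0 ltac:(lra) ltac:(lra).
  rewrite mul1r mul0r; apply => h /=; rewrite /Wz /= -/m; lra.
have le1 : 1 <= P V + (P Wp + P Wm + P Wz).
  rewrite /P -!expectD -[leLHS](expect_cst lP); apply: (expect_le lP) => h.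
  have [hV|hV] := boolP `[< V h >].
    by rewrite lerDl !addr_ge0.
  rewrite add0r; have [mh|mh] := leP (m h) 0.
    have -> : `[< Wz h >] by apply/asboolP.
    by rewrite lerDr addr_ge0.
  have [hp|hp] := boolP `[< Wp h >]; first by rewrite -addrA lerDl addr_ge0.
  have -> : `[< Wm h >].
    apply/asboolP; split => //; move/asboolPn: hp => hp; move/asboolPn: hV => hV.
    rewrite ltNge; apply/negP => hm; apply: hV; split=> //.
    have hp' : m (h * g)%g <= m h * (1 + eps).
      by rewrite leNgt; apply/negP => h'; apply: hp.
    rewrite ler_norml lerBrDr lerBlDr ler_pdivlMr // ler_pdivrMr //.
    by rewrite mulrC [_ + 1]addrC hm /= mulrC [_ + 1]addrC.
  by rewrite add0r lerDl.
move: le1; rewrite -/(P _) mulr2n; lra.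
Qed.

End Density.

(** * The given walk in terms of laws *)

Section Identification.
Variables (R : realType) (F : finGroupType).
Local Notation G := (wreath Z2 F).

Lemma lamp_law_nonneg : nonneg_weights (lamp_law R F).
Proof. by case: (lamp_lawP R F). Qed.

Lemma push_uniform :
  push (@lamp_embed Z2 F) (@uniform_mass R F) = density (lamp_law R F).
Proof.
pose lF := [seq ((#|F|%:R^-1 : R), b) | b <- enum F].
have lF0 : nonneg_weights lF by move=> p /mapP[b _ ->]; rewrite invr_ge0.
rewrite -(push_density _ lF0); congr push; apply/funext => b.
rewrite /density /expect big_map (bigD1_seq b) ?enum_uniq ?mem_enum //=.
by rewrite eqxx mulr1 big1 ?addr0 // => b' /negPf ->; rewrite mulr0.
Qed.

Lemma push_base (m : Z2 -> R) (g : G) : (forall z, 0 <= m z) ->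
  push (@base_embed Z2 F) m g =
  if g == base_embed F (pos g) then m (pos g) else 0.
Proof.
move=> m0; rewrite /push /mass; case: eqP => [e|ne].
  rewrite (_ : _ @^-1` _ = [set pos g]) ?esum_set1 ?lee_fin //.
  by apply/seteqP; split=> z /= => [<-|->]; rewrite -?e.
rewrite (_ : _ @^-1` _ = set0) ?esum_set0 //.
by apply/seteqP; split=> z //= zg; apply: ne; rewrite -zg.
Qed.

(** The step distribution [muZ] may have infinite support, so it is not a priori
    a law.  But elements of the wreath product with cursor [z] only see the mass
    of [muZ] at [z], and on them the switch-walk-switch measure agrees with the
    one built from this single atom. *)
Lemma nu_eq (muZ : Z2 -> R) : (forall z, 0 <= muZ z) ->
  push (@cursor _ F) (switch_walk_switch (F := F) muZ) = muZ.
Proof.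
move=> m0; pose L := lamp_law R F; have L0 := lamp_law_nonneg.
pose lz z : seq (R * G) := [:: (muZ z, base_embed F z)].
have lz0 z : nonneg_weights (lz z).
  by move=> p; rewrite inE => /eqP -> /=; apply: m0.
have E (m : G -> R) g : (forall x, 0 <= m x) ->
    convolution (convolution (density L) m) (density L) g =
    expect L (fun y => expect L (fun x => m (x^-1 * (g * y^-1))%g)).
  move=> mp; rewrite (convolution_densityr g L0).
    by apply: eq_expect => y; apply: convolution_densityl.
  move=> x; rewrite (convolution_densityl x L0 mp).
  by apply: (expect_ge0 (lamp_lawP R F)).
apply/funext => z; rewrite {1}/push /mass.
pose l3 : seq (R * G) := law_mul (law_mul L (lz z)) L.
have l30 : nonneg_weights l3.
  by apply: law_mul_nonneg => //; apply: law_mul_nonneg.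
have -> : (\esum_(g in @cursor _ F @^-1` [set z]) (switch_walk_switch (F := F) muZ g)%:E =
   mass (density l3) (@cursor _ F @^-1` [set z]))%E.
  apply: eq_esum => g gz; congr EFin.
  rewrite -!convolution_density //; last exact: law_mul_nonneg.
  rewrite /switch_walk_switch push_uniform.
  have p0 x : 0 <= push (@base_embed Z2 F) muZ x by rewrite push_base //; case: ifP.
  rewrite !E //; last by move=> x; apply: density_ge0.
  rewrite !expect_lamp; apply: eq_bigr => b _; congr (_ * _).
  rewrite !expect_lamp; apply: eq_bigr => b' _; congr (_ * _).
  set x := (_ * (_ * _))%g.
  have xz : pos x = z.
    by rewrite !posM !posV !pos_lamp oppr0 add0r addr0; exact: gz.
  rewrite push_base // xz /density /expect big_seq1 /= eq_sym.
  by case: eqP; rewrite ?mulr1 ?mulr0.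
have single (f : G -> R) : expect (lz z) f = muZ z * f (base_embed F z).
  by rewrite /expect big_seq1.
rewrite mass_density //= /l3 !expect_mul.
rewrite -[RHS](expect_cst (lamp_lawP R F)) [LHS]expect_lamp [RHS]expect_lamp.
apply: eq_bigr => b _.
congr (_ * _); rewrite single.
rewrite -[RHS]mulr1 -[X in _ = _ * X](expect_cst (lamp_lawP R F)).
congr (_ * _); rewrite [LHS]expect_lamp [RHS]expect_lamp; apply: eq_bigr => b' _; congr (_ * _).
suff -> : `[< cursor (lamp_embed Z2 b * base_embed F z * lamp_embed Z2 b')%g = z >] by [].
apply/asboolP; rewrite -[cursor _]/(pos _).
by rewrite !posM !pos_lamp pos_base add0r addr0.
Qed.

Lemma steps_uniq : uniq steps. Proof. by []. Qed.

Lemma step_density (m : Z2 -> R) : (forall z, z \notin steps -> m z = 0) ->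
  m = density (step_law m).
Proof.
move=> m0; apply/funext => z; rewrite /density /expect big_map /=.
have [zs|zs] := boolP (z \in steps).
  rewrite (bigD1_seq z) ?steps_uniq //= eqxx mulr1.
  by rewrite big1 ?addr0 // => a /negPf ->; rewrite mulr0.
rewrite (m0 _ zs) big_seq big1 // => a al.
by case: eqP => [e|_]; [rewrite -e al in zs|rewrite mulr0].
Qed.

Lemma switch_law_density (m : Z2 -> R) : (forall z, 0 <= m z) ->
  (forall z, z \notin steps -> m z = 0) ->
  switch_walk_switch (F := F) m = density (switch_law m F).
Proof.
move=> m0 mN; have L0 := lamp_law_nonneg.
have s0 : nonneg_weights (step_law m) by move=> p /mapP[a _ ->]; apply: m0.
rewrite /switch_walk_switch push_uniform {1}(step_density mN) push_density //.
have b0 : nonneg_weights (law_map (@base_embed Z2 F) (step_law m)).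
  exact: law_map_nonneg.
by rewrite !convolution_density //; apply: law_mul_nonneg.
Qed.

Lemma lazy_walk_exists (m : Z2 -> R) : prob_mass m -> symmetric_mass m ->
  [set z | m z != 0] = Z2_steps -> exists k, lazy_walk m k.
Proof.
move=> [m0 m1] ms msupp.
have mN z : z \notin steps -> m z = 0.
  move=> zs; apply/eqP; apply: contraNT zs => mz.
  have : [set z | m z != 0] z by [].
  by rewrite msupp.
have mP z : z \in steps -> 0 < m z.
  move=> zs; rewrite lt_neqAle m0 andbT eq_sym.
  have : Z2_steps z by [].
  by rewrite -msupp.
have s0 : nonneg_weights (step_law m) by move=> p /mapP[a _ ->]; apply: m0.
exists (Num.min (m (0, 0)) (Num.min (m (1, 0)) (m (0, 1)))); split=> //.
- split=> //; move: m1; rewrite -[esum _ _]/(mass m setT) {1}(step_density mN) mass_density //.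
  move=> [<-]; apply: eq_bigr => p _; rewrite (_ : `[< _ >] = true) ?mulr1 //.
  exact/asboolP.
- by rewrite !lt_min !mP // !inE.
move=> a; have e1 : m (-1, 0) = m (1, 0) := ms (1, 0).
have e2 : m (0, -1) = m (0, 1) := ms (0, 1).
rewrite !inE => /orP[/eqP->|/orP[/eqP->|/orP[/eqP->|/orP[/eqP->|/eqP->]]]].
- by rewrite !ge_min lexx.
- by rewrite !ge_min lexx orbT.
- by rewrite e1 !ge_min lexx orbT.
- by rewrite !ge_min lexx !orbT.
- by rewrite e2 !ge_min lexx !orbT.
Qed.

End Identification.

Section CoverProbability.
Variables (R : realType) (nu : Z2 -> R) (k : R) (nuP : lazy_walk nu k).
Variable nuN : forall z, z \notin steps -> nu z = 0.

Fixpoint path_law n : seq (R * n.-tuple Z2) :=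
  if n is n'.+1 then
    [seq (p.1 * q.1, cons_tuple p.2 q.2) | p <- step_law nu, q <- path_law n']
  else [:: (1, [tuple])].

Lemma path_lawS n : path_law n.+1 =
  [seq (p.1 * q.1, cons_tuple p.2 q.2) | p <- step_law nu, q <- path_law n].
Proof. by []. Qed.

Lemma expect_pathS n (f : n.+1.-tuple Z2 -> R) : expect (path_law n.+1) f =
  expect (step_law nu) (fun a => expect (path_law n) (fun s => f (cons_tuple a s))).
Proof.
rewrite path_lawS /expect big_allpairs_dep /=; apply: eq_bigr => p _.
by rewrite mulr_sumr; apply: eq_bigr => q _; rewrite mulrA.
Qed.

Lemma path_lawP n : is_law (path_law n).
Proof.
have [n0 n1] := lazy_law nuP.
elim: n => [|n [IH0 IH1]].
  by split; [move=> p; rewrite inE => /eqP -> /=|rewrite big_seq1].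
split=> [p /allpairsP[[p1 p2] [p1l p2l ->]] /=|].
  by apply: mulr_ge0; [apply: n0|apply: IH0].
rewrite -[RHS](expect_cst (conj n0 n1)) -[RHS](eq_expect _ (fun a =>
  expect_cst (conj IH0 IH1) 1)) -(expect_pathS (fun=> 1)).
by apply: eq_bigr => p _; rewrite mulr1.
Qed.

Lemma path_density n (s : n.-tuple Z2) :
  \prod_(x <- s) nu x = density (path_law n) s.
Proof.
elim: n s => [|n IH] s.
  by rewrite tuple0 big_nil /density /expect big_seq1 mul1r eqxx.
case/tupleP: s => a s; rewrite big_cons IH {1}(step_density nuN).
rewrite /density expect_pathS mulrC -expectZ; apply: eq_expect => b.
rewrite mulrC -expectZ; apply: eq_expect => t.
rewrite -natrM mulnb; congr (nat_of_bool _)%:R.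
Qed.

(** The sites other than 0 have to be visited after the first step. *)
Lemma covers_cons (K : set Z2) a (s : seq Z2) :
  (K `<=` visited (a :: s)) <->
  ([set w | K (w + a) /\ w <> - a] `<=` visited s).
Proof.
split=> [KV w [/= Kw wa]|KV z Kz].
  have [[|j] js] := KV _ Kw.
    by rewrite take0 big_nil => /eqP; rewrite addr_eq0 => /eqP.
  rewrite /= big_cons addrC => /addrI wE; by exists j.
have [->|/eqP z0] := eqVneq z 0; first by exists 0%N => //; rewrite take0 big_nil.
have [|j js zE] := KV (z - a).
  by split; rewrite /= ?subrK // => /eqP; rewrite subr_eq addNr => /eqP.
by exists j.+1 => //; rewrite /= big_cons -zE addrC subrK.
Qed.

(** The two recursions translate the set in opposite directions; they agree
    because the steps are symmetric. *)
Lemma miss_path n (K : set Z2) :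
  expect (path_law n) (fun s => (`[< ~ (K `<=` visited s) >])%:R) = miss nu n K.
Proof.
elim: n K => [|n IH] K.
  rewrite /expect big_seq1 mul1r /=; congr (nat_of_bool _)%:R.
  apply: asbool_equiv_eq; apply: not_iff_compat.
  split=> KV z /KV /=.
    by case=> j _ ->; rewrite big_nil.
  by move=> ->; exists 0%N => //; rewrite take0 big_nil.
rewrite expect_pathS [RHS]/= -[RHS](expect_steps_opp nuP); apply: eq_expect => a.
rewrite -IH; apply: eq_expect => s; congr (nat_of_bool _)%:R.
apply: asbool_equiv_eq; apply: not_iff_compat.
rewrite covers_cons; by split=> H w; have := H w; rewrite /= opprK.
Qed.

Lemma miss_of_covers n (K : set Z2) (e : R) :
  ((1 - e)%:E <= prob_covers nu n K)%E -> miss nu n K <= e.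
Proof.
rewrite /prob_covers.
under eq_esum do rewrite path_density.
have p0 : nonneg_weights (path_law n) by case: (path_lawP n).
rewrite -/(mass _ _) mass_density // lee_fin -miss_path.
have <- : expect (path_law n) (fun s => 1 - (`[< K `<=` visited s >])%:R) =
  expect (path_law n) (fun s => (`[< ~ (K `<=` visited s) >])%:R).
  apply: eq_expect => s; rewrite asbool_neg.
  by case: asbool; rewrite ?subrr ?subr0.
rewrite expectB (expect_cst (path_lawP n)); lra.
Qed.

End CoverProbability.

(** * Word length controls displacement and lamps *)

Section WordBounds.
Variable F : finGroupType.
Local Notation G := (wreath Z2 F).
Implicit Types (g h : G) (C : nat) (S : {fset G}).

Definition bounded C g := (len (pos g) <= C)%N /\ lamp_supp g `<=` ball C.

Lemma bounded1 C : bounded C (1%g : G).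
Proof. by split=> // w; rewrite /lamp_supp /= /lamp fsfun0E eqxx. Qed.

Lemma boundedW C D g : (C <= D)%N -> bounded C g -> bounded D g.
Proof.
move=> CD [g1 g2]; split; first exact: leq_trans CD.
by move=> w /g2 /leq_trans; apply.
Qed.

Lemma boundedM C D g h : bounded C g -> bounded D h -> bounded (C + D) (g * h)%g.
Proof.
move=> [g1 g2] [h1 h2]; split.
  by rewrite posM; apply: leq_trans (lenD _ _) _; apply: leq_add.
move=> w; rewrite /lamp_supp /= lampM => gh.
have [gw|gw] := eqVneq (lamp g w) 1%g; last first.
  by apply: leq_trans (g2 w gw) _; apply: leq_addr.
rewrite gw mul1g in gh; have := h2 _ gh; rewrite /ball /= => hw.
rewrite -[w](subrK (pos g)); apply: leq_trans (lenD _ _) _.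
by rewrite addnC; apply: leq_add.
Qed.

Lemma boundedV C g : bounded C g -> bounded C.*2 (g^-1)%g.
Proof.
move=> [g1 g2]; split.
  by rewrite posV lenN (leq_trans g1) // -addnn leq_addr.
move=> w; rewrite /lamp_supp /= lampV => gw.
have {}gw : lamp g (w + pos g)%R != 1%g.
  by apply: contraNneq gw => ->; rewrite invg1.
have := g2 _ gw; rewrite /ball /= => hw.
rewrite -[w](addrK (pos g)) -addnn; apply: leq_trans (lenD _ _) _.
by rewrite lenN; apply: leq_add.
Qed.

Lemma bounded_ex g : exists C, bounded C g.
Proof.
exists (len (pos g) + \max_(z <- finsupp g.2) len z)%N; split.
  exact: leq_addr.
move=> w gw; apply: leq_trans (leq_addl _ _).
by apply: leq_bigmax_seq => //; rewrite mem_finsupp.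
Qed.

Lemma bounded_seq (l : seq G) : exists C, forall g, g \in l -> bounded C g.
Proof.
elim: l => [|g l [C IH]]; first by exists 0%N.
have [D gD] := bounded_ex g; exists (maxn C D) => h.
rewrite inE => /orP[/eqP->|/IH hC]; first exact: boundedW (leq_maxr _ _) gD.
exact: boundedW (leq_maxl _ _) hC.
Qed.

Lemma word_bounded S : generates S ->
  exists C, forall g, bounded (C * word_length S g) g.
Proof.
move=> genS; have [C SC] := bounded_seq S; exists C.*2 => g.
rewrite /word_length; case: pselect => [ex|]; last first.
  by case; have [n gn] := genS g; exists n; apply/asboolP.
case: ex_minnP => m /asboolP[w [wS <- <-]] _ {ex m}.
elim: w wS => [|s w IH] /=; first by rewrite big_nil => _; apply: bounded1.
move=> /andP[sS wS]; rewrite big_cons mulnS; apply: boundedM (IH wS).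
case/orP: sS => [/SC|/SC/boundedV]; last by rewrite invgK.
by apply: boundedW; rewrite -addnn leq_addr.
Qed.

End WordBounds.

(** * Almost invariance *)

Section Main.
Variables (R : realType) (nu : Z2 -> R) (k : R) (nuP : lazy_walk nu k).
Variable F : finGroupType.
Local Notation G := (wreath Z2 F).

Lemma bounded_cost n m M L s r (f : G -> R) (g : G) : unit_valued f ->
  (0 < L)%N -> (0 < s)%N -> (s ^ 2 <= M)%N -> n = (m + M)%N -> bounded r g ->
  `|expect (chain_law nu F n) (fun h => f (h * g)%g) -
    expect (chain_law nu F n) f| <=
  miss nu n (ball r) + (2 * (miss nu m (ball L) + 2 / (L ^ 2)%N%:R * M%:R) +
  smooth_cst k * (r%:R / s%:R)).
Proof.
move=> f01 L0 s0 sM nE [g1 g2].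
pose h' := (g * (base_embed F (pos g))^-1)%g.
have h'0 : pos h' = 0 by rewrite posM posV pos_base subrr.
pose f' (h : G) := f (h * base_embed F (pos g))%g.
have f'01 : unit_valued f' by move=> h; apply: f01.
have le1 := lamps_cost nuP n f'01 h'0.
have le2 := shift_cost nuP m (pos g) f01 L0 s0 sM.
have gE h : (h * g = h * h' * base_embed F (pos g))%g.
  by rewrite /h' !mulgA mulgKV.
rewrite (eq_expect _ (fun h => congr1 f (gE h))).
apply: le_trans (ler_distD (expect (chain_law nu F n) f') _ _) _.
apply: lerD.
  apply: le_trans le1 _; rewrite /h' strip_supp; exact: (miss_mono nuP).
rewrite nE; apply: le_trans le2 _; rewrite lerD2l ler_wpM2l ?ler_wpM2r //.
- by rewrite ltW // (smooth_cst_gt0 nuP).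
- by rewrite ler_nat.
Qed.

Lemma ball_sub C D : (C <= D)%N -> ball C `<=` ball D.
Proof. by move=> CD w /leq_trans; apply. Qed.

(** The scales are M = (s r)^2, L = s^2 r and D = 2^I L.  The covering hypothesis
    for the radius 3 D provides the balls of radius [L] around all points within
    2 D of the origin, as [miss_earlier] requires. *)
Lemma almost_invariant n (c : R) s I r (g : G) (f : G -> R) :
  (0 < s)%N -> I = (6400 * (s ^ 2).+3 * s)%N -> (0 < n)%N ->
  0 <= c -> c + s%:R^-1 < 1 -> bounded r g ->
  miss nu n (ball (3 * (2 ^ I * (s ^ 2 * r)))) <= c -> unit_valued f ->
  `|expect (law_pow (switch_law nu F) n) (fun h => f (h * g)%g) -
    expect (law_pow (switch_law nu F) n) f| <=
  3 * c + (6 + 7 * smooth_cst k) / s%:R.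
Proof.
move=> s0 IE n0 c0 cs gr missn f01.
have Cgt := smooth_cst_gt0 nuP; have sgt : 0 < s%:R :> R by rewrite ltr0n.
have s2 : (s ^ 2 * r >= r)%N by rewrite leq_pmull // expn_gt0 s0.
have p2 x : (x <= 2 ^ I * x)%N by rewrite leq_pmull // expn_gt0.
have missr : miss nu n (ball r) <= c.
  apply: le_trans missn; apply: (miss_mono nuP); apply: ball_sub.
  by apply: leq_trans (leq_pmull _ _) => //; apply: leq_trans (p2 _).
case: n n0 missn missr => // n _ missn missr.
rewrite !switch_powE.
(* For r = 0 the scales vanish, but [g] is only a lamp at the cursor. *)
have [r0|r0] := posnP r.
  have g1 : pos g = 0.
    case: gr => + _; rewrite r0 leqn0 addn_eq0 !absz_eq0 => /andP[/eqP g1 /eqP g2].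
    by case: (pos g) g1 g2 => z1 z2 /= -> ->.
  apply: le_trans (lamps_cost nuP n.+1 f01 g1) _.
  apply: le_trans (miss_mono nuP _ gr.2) _; apply: le_trans missr _.
  have : 0 <= (6 + 7 * smooth_cst k) / s%:R :> R.
    by apply: divr_ge0 => //; lra.
  lra.
pose L := (s ^ 2 * r)%N; pose M := ((s * r) ^ 2)%N.
have L0 : (0 < L)%N by rewrite muln_gt0 expn_gt0 s0.
have MD : (M <= (2 ^ I * L) ^ 2)%N.
  rewrite /M leq_exp2r //; apply: leq_trans (p2 _).
  by rewrite /L -mulnn -mulnA leq_pmull.
have := miss_earlier nuP (s := s) (L := L) (M := M) (n := n.+1) (e := c) s0 L0.
rewrite -IE => /(_ MD cs) [].
  move=> v vD; apply: le_trans missn; apply: (miss_mono nuP) => w /=.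
  rewrite /ball /= => wv; rewrite -[w](addrK v); apply: leq_trans (lenD _ _) _.
  rewrite lenN -/L [X in (_ <= X)%N]mulSn mul2n; apply: leq_add => //.
  by apply: leq_trans wv _; apply: p2.
move=> Mn missL.
have := bounded_cost (n := n.+1) (m := n.+1 - M) (M := M) (L := L) (s := s * r) f01 L0.
move=> /(_ r g) H; have {}H := H _ (leqnn _) _ gr.
apply: le_trans (H _ _) _; first by rewrite muln_gt0 s0.
  by rewrite subnK // ltnW.
have mL : miss nu (n.+1 - M) (ball L) = miss_at nu (n.+1 - M) (ball L) 0.
  rewrite /miss_at; congr (miss nu _ _); apply/seteqP.
  by split=> w /=; rewrite addr0.
rewrite mL.
have rgt : 0 < r%:R :> R by rewrite ltr0n.
have -> : 2 / (L ^ 2)%N%:R * M%:R = 2 / s%:R ^+ 2 :> R.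
  by rewrite /L /M !(natrX, natrM); field; rewrite !gt_eqF.
have -> : r%:R / (s * r)%N%:R = s%:R^-1 :> R.
  by rewrite natrM; field; rewrite !gt_eqF.
have i1 : s%:R^-1 <= 1 :> R by rewrite invf_le1 // ler1n.
have i0 : 0 < s%:R^-1 :> R by rewrite invr_gt0.
have -> : 2 / s%:R ^+ 2 = 2 * (s%:R^-1 * s%:R^-1) :> R by field; rewrite gt_eqF.
move: missL; rewrite !mulrA ![_ / s%:R]mulrC.
set u := s%:R^-1 in i0 i1 *; set C := smooth_cst k.
move=> missL; have u2 : u * u <= u by rewrite ger_pMl.
have uC : u * (6 + 7 * C) = 6 * u + 7 * (C * u) by ring.
nra.
Qed.

End Main.

Theorem proposition4p7 (R : realType) (F : finGroupType) (F2 : (2 <= #|F|)%N)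
    (mu : wreath (int * int)%type F -> R)
    (sws : standard_switch_walk_switch mu) (ap : aperiodic mu)
    (nu : (int * int)%type -> R) (nuE : nu = push (@cursor _ F) mu)
    (nu_supp : [set z | nu z != 0] = Z2_steps)
    (S : {fset wreath (int * int)%type F}) (genS : generates S)
    (rcov : nat -> R) (rcov_ge0 : forall n, 0 <= rcov n)
    (rcovP : cov_radius nu rcov) :
  invariance_radius_succeq S mu rcov.
Proof.
case: sws => muZ [muZP muZsym muE].
have muZnu : muZ = nu by rewrite nuE muE nu_eq //; case: muZP.
rewrite {}muZnu in muZP muZsym muE; have nu0 := muZP.1.
have [k nuP] := lazy_walk_exists muZP muZsym nu_supp.
have nuN z : z \notin steps -> nu z = 0.
  move=> zs; apply/eqP; apply: contraNT zs => mz.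
  have : [set z | nu z != 0] z by [].
  by rewrite nu_supp.
pose l := switch_law nu F.
have lP : is_law l := switch_lawP nuP F.
have muD : mu = density l by rewrite muE switch_law_density.
have [C gC] := word_bounded genS.
have Cgt := smooth_cst_gt0 nuP.
move=> r' r'0 [rc0 rc] eps eps0 g gr.
(* Total variation at most eps^2/2 gives exceptional mass at most eps. *)
pose delta := eps ^+ 2 / 2.
have d0 : 0 < delta by rewrite divr_gt0 // exprn_gt0.
pose e := Num.min (delta / 6) (1 / 4).
have e0 : 0 < e by rewrite lt_min; apply/andP; split; lra.
have e14 : e <= 1 / 4 by rewrite ge_min lexx orbT.
have ed : e <= delta / 6 by rewrite ge_min lexx.
pose s := maxn 3 (Num.bound ((6 + 7 * smooth_cst k) * 2 / delta)).
have s0 : (0 < s)%N by rewrite leq_max.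
have sgt : 0 < s%:R :> R by rewrite ltr0n.
have s3 : s%:R^-1 <= 3^-1 :> R.
  by rewrite lef_pV2 ?posrE // ler_nat leq_maxl.
have sd : (6 + 7 * smooth_cst k) / s%:R <= delta / 2.
  have h : (6 + 7 * smooth_cst k) * 2 / delta <= s%:R.
    apply: le_trans (ltW (archi_boundP _)) _; last by rewrite ler_nat leq_maxr.
    by apply: divr_ge0; lra.
  rewrite ler_pdivrMr // mulrAC ler_pdivlMr //; move: h.
  by rewrite ler_pdivrMr // [s%:R * _]mulrC.
pose I := (6400 * (s ^ 2).+3 * s)%N.
(* The radius 3 D is [Q] times the word length of [g n]; the factor 2 in [C.*2]
   comes from applying [almost_invariant] to the inverse of [g n]. *)
pose Q := (3 * (2 ^ I * (s ^ 2 * C.*2)))%N.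
have [c c0 cov] := rcovP e e0.
exists (fun n => [set h | 0 < conv_pow mu n h /\
  `|conv_pow mu n (h * g n)%g / conv_pow mu n h - 1| <= eps]).
have cQ : 0 < c / Q.+1%:R by rewrite divr_gt0.
near=> n.
split; last by [].
have n0 : (0 < n)%N by near: n; exact: nbhs_infty_gt.
have rn : Q%:R * (word_length S (g n))%:R <= c * rcov n.
  have wr := gr n.
  have [r0|r0] := eqVneq (rcov n) 0.
    have w0 : (word_length S (g n))%:R <= 0 :> R.
      apply: le_trans wr _; suff -> : r' n = 0 by [].
      by move: r0; near: n.
    have -> : (word_length S (g n))%:R = 0 :> R by apply/eqP; rewrite eq_le w0 ler0n.
    by rewrite r0 !mulr0.
  have rgt : 0 < rcov n by rewrite lt_neqAle eq_sym r0 rcov_ge0.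
  have : r' n / rcov n <= c / Q.+1%:R.
    by near: n; apply: (cvgr_le 0).
  rewrite ler_pdivrMr // => h; have {h wr}h := le_trans wr h.
  have Q1 : Q%:R <= Q.+1%:R :> R by rewrite ler_nat.
  apply: le_trans (ler_wpM2r (ler0n _ _) Q1) _.
  by rewrite mulrC -ler_pdivlMr ?ltr0n // mulrAC.
have missn : miss nu n (ball (3 * (2 ^ I * (s ^ 2 * (C * word_length S (g n)).*2)))) <= e.
  have h : ((1 - e)%:E <= prob_covers nu n (Z2_ball (c * rcov n)))%E by near: n.
  apply: le_trans (miss_of_covers nuP nuN h).
  apply: (miss_mono nuP) => z; rewrite /ball /Z2_ball /= => zl.
  apply: le_trans rn; rewrite -natrM -[_%:~R]/((_ : int)%:~R).
  have -> : (`|z.1| + `|z.2|)%:~R = (len z)%:R :> R.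
    by rewrite /len natrD !natr_absz -intrD.
  rewrite ler_nat; apply: leq_trans zl _.
  by rewrite /Q doubleMl !mulnA.
have gV := boundedV (gC (g n)).
rewrite muD conv_pow_density ?lP.1 //; last exact: lP.1.
rewrite mass_density; last exact: (law_powP n lP).1.
rewrite lee_fin; apply: le_trans
  (almost_invariant_mass (delta := delta) (law_powP n lP) eps0 _).
  rewrite lerD2l lerN2 /delta.
  rewrite [leLHS](_ : _ = eps) //; by field; rewrite gt_eqF.
move=> f f01.
apply: le_trans (almost_invariant nuP s0 (erefl I) n0 (ltW e0) _ gV missn f01) _.
  lra.
lra.
Unshelve. all: by end_near.
Qed.
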